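(* For $d=3,7,11$ the group $\mathrm{PU}(2,1,\mathcal{O}_d)$ has a subgroup of index $2$ which is generated by real reflections; for $d=2$ the group $\mathrm{PU}(2,1,\mathcal{O}_2)$ has a subgroup of index $4$ which is generated by real reflections; and for $d=1$ the group $\mathrm{PU}(2,1,\mathcal{O}_1)$ has a subgroup of index $8$ which is generated by real reflections.
   Context: $\mathrm{H}^2_{\mathbb{C}}\subset\mathbb{C}P^2$ is the complex hyperbolic plane, i.e. the set of lines negative for the Hermitian form of signature $(2,1)$ on $\mathbb{C}^3$ given by $\langle Z,W\rangle=z_1\overline{w_3}+z_2\overline{w_2}+z_3\overline{w_1}$; $\mathrm{U}(2,1)$ is the unitary group of this form and $\mathrm{PU}(2,1)$ its projectivization, the group of holomorphic isometries of $\mathrm{H}^2_{\mathbb{C}}$. For a positive squarefree integer $d$, $\mathcal{O}_d$ is the ring of integers of $\mathbb{Q}[\sqrt{-d}]$. $\mathrm{PU}(2,1,\mathcal{O}_d)$ is the image in $\mathrm{PU}(2,1)$ of the group of matrices in $\mathrm{U}(2,1)$ with entries in $\mathcal{O}_d$ (for $d\neq 3$ this is the same as the isomorphic image of $\mathrm{SU}(2,1,\mathcal{O}_d)$, the group of matrices in $\mathrm{SU}(2,1)$ with entries in $\mathcal{O}_d$). A real reflection is an antiholomorphic isometric involution of $\mathrm{H}^2_{\mathbb{C}}$ whose fixed-point set is a real plane (the projective image of a totally real subspace $W\subset\mathbb{C}^3$ of real dimension 3 meeting the negative vectors, where totally real means $\langle v,w\rangle\in\mathbb{R}$ for all $v,w\in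 W$). Convention: a subgroup of $\mathrm{PU}(2,1)$ is said to be generated by real reflections if it is the index 2 holomorphic subgroup (the subgroup of holomorphic elements) of a group of isometries of $\mathrm{H}^2_{\mathbb{C}}$ generated by real reflections. *)

(* Defs.v *)
From HB Require Import structures.
From mathcomp Require Import all_boot all_order all_algebra.
From mathcomp Require Import complex.
From mathcomp Require Import all_classical all_reals all_analysis.

Set Implicit Arguments.
Unset Strict Implicit.
Unset Printing Implicit Defensive.

Import Order.TTheory GRing.Theory Num.Theory.
Import numFieldNormedType.Exports.

Local Open Scope classical_set_scope.
Local Open Scope card_scope.
Local Open Scope ring_scope.

Section TransformationGroups.
Variable X : Type.
Implicit Types G H S : set (X -> X).

Definition transformation_group G :=
  [/\ G id,
      forall f g, G f -> G g -> G (f \o g) &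
      forall f, G f -> exists2 g, G g & cancel f g /\ cancel g f].

Definition subgroup H G := transformation_group H /\ H `<=` G.

(* The group generated by S, provided that S consists of bijections. *)
Definition generated S : set (X -> X) := smallest transformation_group S.

Definition has_index H G (n : nat) :=
  [set [set g \o h | h in H] | g in G] #= `I_n.

End TransformationGroups.

Section ComplexHyperbolicPlane.
Variable R : realType.
Local Notation C := R[i].
Local Notation V := 'cV[C]_3.

Definition herm (Z W : V) : C :=
  Z 0 0 * (W 2 0)^* + Z 1 0 * (W 1 0)^* + Z 2 0 * (W 0 0)^*.

Definition negative_line (L : {vspace V}) : bool :=
  (\dim L == 1%N) && `[< forall v, v \in L -> v != 0 -> herm v v < 0 >].

Definition H2C := {L : {vspace V} | negative_line L}.

(* The Bergman distance, with cosh^2 (dist p q / 2) =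
   <u, v><v, u> / (<u, u><v, v>) for any nonzero u in p and v in q. *)
Definition arcosh (x : R) : R := ln (x + Num.sqrt (x ^+ 2 - 1)).

Definition dist (p q : H2C) : R :=
  let u := vpick (val p) in let v := vpick (val q) in
  2 * arcosh (Num.sqrt
    (complex.Re (herm u v * herm v u / (herm u u * herm v v)))).

Definition isometric (f : H2C -> H2C) := forall p q, dist (f p) (f q) = dist p q.

(* A negative vector has a nonzero last coordinate, so this global affine chart
   identifies H2C with the Siegel domain, an open subset of C^2. *)
Definition chart (p : H2C) : C^o * C^o :=
  let v := vpick (val p) in (v 0 0 / v 2 0, v 1 0 / v 2 0).

(* F is f read in the chart; its values off the (open) Siegel domain play no
   role. As C^o * C^o is normed over C, differentiable means
   complex-differentiable. *)
Definition holomorphic (f : H2C -> H2C) :=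
  exists F : C^o * C^o -> C^o * C^o,
    (forall p, F (chart p) = chart (f p)) /\
    (forall p, differentiable F (chart p)).

Definition antiholomorphic (f : H2C -> H2C) :=
  exists F : C^o * C^o -> C^o * C^o,
    (forall p, F (chart p) = (((chart (f p)).1)^*, ((chart (f p)).2)^*)) /\
    (forall p, differentiable F (chart p)).

Definition real_3_subspace (W : set V) :=
  exists b : 'I_3 -> V,
    (forall r : 'I_3 -> R,
       \sum_k ((r k)%:C)%C *: b k = 0 -> forall k, r k = 0) /\
    W = [set \sum_k ((r k)%:C)%C *: b k | r in [set: 'I_3 -> R]].

Definition totally_real (W : set V) :=
  forall v w, W v -> W w -> herm v w \is Num.real.

Definition real_plane (P : set H2C) :=
  exists W : set V,
    [/\ real_3_subspace W, totally_real W,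
        exists2 v, W v & herm v v < 0 &
        P = [set p : H2C | exists v, [/\ W v, v != 0 & v \in val p]]].

Definition real_reflection (f : H2C -> H2C) :=
  [/\ antiholomorphic f, isometric f, involutive f &
      real_plane [set p : H2C | f p = p]].

Definition U21 : set 'M[C]_3 :=
  [set A | forall Z W, herm (A *m Z) (A *m W) = herm Z W].

Definition induces (A : 'M[C]_3) (f : H2C -> H2C) :=
  forall p, val (f p) = (linfun (mulmx A) @: val p)%VS.

(* The ring of integers of Q(sqrt (-d)), embedded in C. *)
Definition ring_of_integers (d : nat) : set C :=
  [set z | (exists a b : rat, z = ratr a + ratr b * sqrtC (- d%:R)) /\
           integralOver (intr : int -> C) z].

(* PU(2,1) acts faithfully on H2C, so its elements are represented by the
   transformations they induce. *)
Definition PU21_O (d : nat) : set (H2C -> H2C) :=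
  [set f | exists A : 'M[C]_3,
     [/\ U21 A, forall i j, ring_of_integers d (A i j) & induces A f]].

Definition generated_by_real_reflections (H : set (H2C -> H2C)) :=
  exists S : set (H2C -> H2C),
    [/\ S `<=` real_reflection,
        H = generated S `&` holomorphic &
        has_index H (generated S) 2].

End ComplexHyperbolicPlane.

(* Main.v *)
From Stdlib Require Import ZArith Lia FMapPositive.
From HB Require Import structures.
Require Import Defs.
From mathcomp Require Import all_boot all_order all_algebra.
From mathcomp Require Import complex.
From mathcomp Require Import all_classical all_reals all_analysis.

Set Implicit Arguments.
Unset Strict Implicit.
Unset Printing Implicit Defensive.

(** The orders concerned are Z[w] with w^2 = T w - N: (T, N) is (0, 1), (0, 2), (1, 1), (1, 2),
(1, 3) for d = 1, 2, 3, 7, 11. A matrix of Gamma = U(2,1,O_d) is nine pairs of integers, so a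
question about Gamma can be settled by computation.

A real reflection of the complex hyperbolic plane is the map that sends the line of v to the line
of B v^-, where v^- is the complex conjugate of v, for a unitary matrix B with B B^- = 1
([reflection_real]: the vectors v = B v^- form a real form of C^3 by Hilbert 90, and it contains a
negative vector). The product of the reflections given by B and B' is holomorphic with matrix
B B'^-. Hence, if S is a finite set of such matrices with entries in O_d, the holomorphic part of
the group that their reflections generate consists of the maps induced by the even words, which
are the products of the matrices B B'^- with B, B' in S; it has index 2 because a product of an odd
number of reflections is not holomorphic ([generated_alternating], [alternating_index],
[not_holomorphic_motion]). What remains is to exhibit S such that the even words, together with
the units of O_d, form a subgroup of index 2, 4 or 8 in Gamma.

Three kinds of finite data establish this. Generators g_j of Gamma are the first. They come from a
descent on the norm of the lower left entry v3 of a matrix with first column v. If v3 = 0, the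
matrix fixes a cusp and is a product of Heisenberg translations, a diagonal matrix and a unit
([word_cusp]). Otherwise a Heisenberg translation moves (v1 / v3, v2 / v3) into a fixed box; if the
box is covered by the balls |<v, u>| < |v3|, for the first columns u of finitely many words M in
the generators, then M^-1 A has a smaller lower left entry than A ([unitary_word]). That the balls
cover the box is checked by subdividing the box.

The second is a table of the residues of the elements of Gamma modulo an ideal of O_d, each
labelled with a coset number in a way that is compatible with right multiplication by the
generators. The coset number of a matrix is thus well defined; it is 0 on the products B B'^-,
hence on all even words ([even_word_kernel]).

The third is the converse in the manner of Schreier: representatives t_q of the coset numbers and,
for every q and j, an expression t_q g_j = e W t_q' with e a unit, W an even word and q' the coset
number of t_q g_j. By induction on the length of a word in the generators, A = e W t_q with q the
coset number of A; so a matrix of coset number 0 is a unit times an even word ([kernel_even]).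

Finally, two unitary matrices induce the same map only if they are proportional
([motion_faithful]), and units do not change the coset number, so the number of cosets is the same
in PU(2,1,O_d) as in Gamma. *)

(** * Integers of an imaginary quadratic field and matrices over them *)

(** The pair x stands for x.1 + x.2 w, where w is a root of X^2 - T X + N. *)
Definition oint : Type := (Z * Z)%type.

Section Order.
Local Open Scope Z_scope.
Variables T N : Z.
Implicit Types x y z : oint.

Definition ozero : oint := (0, 0).
Definition oone : oint := (1, 0).
Definition oadd x y : oint := (x.1 + y.1, x.2 + y.2).
Definition oopp x : oint := (- x.1, - x.2).
Definition osub x y : oint := (x.1 - y.1, x.2 - y.2).
Definition omul x y : oint :=
  (x.1 * y.1 - N * (x.2 * y.2), x.1 * y.2 + x.2 * y.1 + T * (x.2 * y.2)).
Definition oconj x : oint := (x.1 + T * x.2, - x.2).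
Definition onorm x : Z := x.1 * x.1 + T * (x.1 * x.2) + N * (x.2 * x.2).
Definition otrace x : Z := 2 * x.1 + T * x.2.
Definition oeqb x y : bool := (x.1 =? y.1) && (x.2 =? y.2).

Lemma oint_eq x y : x.1 = y.1 -> x.2 = y.2 -> x = y.
Proof. by case: x y => [a b] [c d] /= -> ->. Qed.

Lemma oeqbP x y : oeqb x y -> x = y.
Proof. by case/andP=> /Z.eqb_eq h1 /Z.eqb_eq h2; apply: oint_eq. Qed.

Lemma oint_ring : ring_theory ozero oone oadd omul osub oopp eq.
Proof.
split=> *; apply: oint_eq; cbv [omul oadd oopp osub ozero oone]; cbn [fst snd]; ring.
Qed.
Add Ring oint_ring : oint_ring.

Lemma oconjD x y : oconj (oadd x y) = oadd (oconj x) (oconj y).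
Proof. by apply: oint_eq; cbv [oconj oadd]; cbn [fst snd]; ring. Qed.
Lemma oconjM x y : oconj (omul x y) = omul (oconj x) (oconj y).
Proof. by apply: oint_eq; cbv [oconj omul]; cbn [fst snd]; ring. Qed.
Lemma oconjN x : oconj (oopp x) = oopp (oconj x).
Proof. by apply: oint_eq; cbv [oconj oopp]; cbn [fst snd]; ring. Qed.
Lemma oconjK x : oconj (oconj x) = x.
Proof. by apply: oint_eq; cbv [oconj]; cbn [fst snd]; ring. Qed.
Lemma oconj0 : oconj ozero = ozero.
Proof. by apply: oint_eq; cbv [oconj ozero]; cbn [fst snd]; ring. Qed.
Lemma oconj1 : oconj oone = oone.
Proof. by apply: oint_eq; cbv [oconj oone]; cbn [fst snd]; ring. Qed.
Lemma onormE x : omul x (oconj x) = (onorm x, 0).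
Proof. by apply: oint_eq; cbv [oconj omul onorm]; cbn [fst snd]; ring. Qed.
Lemma onormM x y : onorm (omul x y) = onorm x * onorm y.
Proof. by cbv [onorm omul]; cbn [fst snd]; ring. Qed.
Lemma onorm1 : onorm oone = 1.
Proof. by rewrite /onorm /oone; cbn [fst snd]; ring. Qed.
Lemma onorm_conj x : onorm (oconj x) = onorm x.
Proof. by cbv [onorm oconj]; cbn [fst snd]; ring. Qed.

(** Nine explicit fields let equality of matrices be decided by computation and let products of
concrete matrices reduce. *)
Record mat : Type := Mat {
  m11 : oint; m12 : oint; m13 : oint;
  m21 : oint; m22 : oint; m23 : oint;
  m31 : oint; m32 : oint; m33 : oint }.
Implicit Types A B C : mat.

Lemma mat_eq A B :
  m11 A = m11 B -> m12 A = m12 B -> m13 A = m13 B ->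
  m21 A = m21 B -> m22 A = m22 B -> m23 A = m23 B ->
  m31 A = m31 B -> m32 A = m32 B -> m33 A = m33 B -> A = B.
Proof. by case: A; case: B => /= *; subst. Qed.

Definition dot a b c x y z := oadd (omul a x) (oadd (omul b y) (omul c z)).

Definition mmul A B : mat :=
  let: Mat a b c d e f g h i := A in
  let: Mat a' b' c' d' e' f' g' h' i' := B in
  Mat (dot a b c a' d' g') (dot a b c b' e' h') (dot a b c c' f' i')
      (dot d e f a' d' g') (dot d e f b' e' h') (dot d e f c' f' i')
      (dot g h i a' d' g') (dot g h i b' e' h') (dot g h i c' f' i').

Definition mone : mat := Mat oone ozero ozero ozero oone ozero ozero ozero oone.

Definition mmap (f : oint -> oint) A : mat :=
  let: Mat a b c d e f' g h i := A in
  Mat (f a) (f b) (f c) (f d) (f e) (f f') (f g) (f h) (f i).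

Definition mconj := mmap oconj.
Definition smat u := mmap (omul u).

(** The adjoint J A^-^T J for the Hermitian form, whose matrix J is antidiagonal. *)
Definition mstar A : mat :=
  let: Mat a b c d e f g h i := A in
  mconj (Mat i f c h e b g d a).

Definition meqb A B : bool :=
  let: Mat a b c d e f g h i := A in
  let: Mat a' b' c' d' e' f' g' h' i' := B in
  [&& oeqb a a', oeqb b b', oeqb c c', oeqb d d', oeqb e e', oeqb f f',
      oeqb g g', oeqb h h' & oeqb i i'].

Lemma meqbP A B : meqb A B -> A = B.
Proof.
case: A; case: B => > /=; do 8 case/andP=> /oeqbP ->.
by move=> /oeqbP ->.
Qed.

Lemma mmulA A B C : mmul A (mmul B C) = mmul (mmul A B) C.
Proof. by case: A; case: B; case: C => *; rewrite /mmul /dot; congr Mat; ring. Qed.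
Lemma mmul1 A : mmul mone A = A.
Proof. by case: A => *; rewrite /mmul /dot /=; congr Mat; ring. Qed.
Lemma mmulm1 A : mmul A mone = A.
Proof. by case: A => *; rewrite /mmul /dot /=; congr Mat; ring. Qed.
Lemma mconjM A B : mconj (mmul A B) = mmul (mconj A) (mconj B).
Proof.
by case: A; case: B => *; rewrite /mconj /mmul /dot /=; congr Mat;
   rewrite !(oconjD, oconjM).
Qed.
Lemma mconjK A : mconj (mconj A) = A.
Proof. by case: A => *; rewrite /mconj /= !oconjK. Qed.
Lemma mstarM A B : mstar (mmul A B) = mmul (mstar B) (mstar A).
Proof.
by case: A; case: B => *; rewrite /mstar /mconj /mmul /dot /=; congr Mat;
   rewrite !(oconjD, oconjM); ring.
Qed.
Lemma mstarK A : mstar (mstar A) = A.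
Proof. by case: A => *; rewrite /mstar /mconj /= !oconjK. Qed.
Lemma mstar_conj A : mstar (mconj A) = mconj (mstar A).
Proof. by case: A => *. Qed.
Lemma mstar1 : mstar mone = mone.
Proof. by rewrite /mstar /mconj /= oconj0 oconj1. Qed.
Lemma mconj1 : mconj mone = mone.
Proof. by rewrite /mconj /= oconj0 oconj1. Qed.
Lemma smatE u A : smat u A = mmul A (smat u mone).
Proof. by case: A => *; rewrite /smat /mmul /dot /=; congr Mat; ring. Qed.
Lemma smatl u A B : mmul (smat u A) B = smat u (mmul A B).
Proof. by case: A; case: B => *; rewrite /smat /mmul /dot /=; congr Mat; ring. Qed.
Lemma smatr u A B : mmul A (smat u B) = smat u (mmul A B).
Proof. by case: A; case: B => *; rewrite /smat /mmul /dot /=; congr Mat; ring. Qed.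
Lemma smatA u v A : smat u (smat v A) = smat (omul u v) A.
Proof. by case: A => *; rewrite /smat /=; congr Mat; ring. Qed.
Lemma smat1 A : smat oone A = A.
Proof. by case: A => *; rewrite /smat /=; congr Mat; ring. Qed.

Definition unitary A := mmul (mstar A) A = mone /\ mmul A (mstar A) = mone.
Definition unitaryb A := meqb (mmul (mstar A) A) mone && meqb (mmul A (mstar A)) mone.
Lemma unitarybP A : unitaryb A -> unitary A.
Proof. by case/andP=> /meqbP h1 /meqbP h2. Qed.
Lemma unitary1 : unitary mone.
Proof. by rewrite /unitary mstar1 mmul1. Qed.
Lemma unitaryM A B : unitary A -> unitary B -> unitary (mmul A B).
Proof.
move=> [a1 a2] [b1 b2]; split; rewrite mstarM.
  by rewrite -mmulA (mmulA (mstar A)) a1 mmul1.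
by rewrite -mmulA (mmulA B) b2 mmul1.
Qed.
Lemma unitary_star A : unitary A -> unitary (mstar A).
Proof. by move=> [a1 a2]; split; rewrite mstarK. Qed.
Lemma unitary_conj A : unitary A -> unitary (mconj A).
Proof. by move=> [a1 a2]; split; rewrite mstar_conj -mconjM ?a1 ?a2 mconj1. Qed.

Lemma mstar_scale u A : mstar (smat u A) = smat (oconj u) (mstar A).
Proof. by case: A => *; rewrite /mstar /smat /mconj /= !oconjM. Qed.
(** These matrices fix the isotropic line of (1, 0, 0), a point at infinity. Their action on the
remaining isotropic lines, seen in the chart v3 = 1, is v2 := v2 + z, v1 := v1 - z^- v2 + x: they
are the translations of the Heisenberg group, with centre z = 0. *)
Definition heis z x : mat :=
  Mat oone (oopp (oconj z)) x ozero oone z ozero ozero oone.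
Definition mdiag x : mat :=
  Mat oone ozero ozero ozero x ozero ozero ozero oone.

Lemma heisM z x w y :
  mmul (heis z x) (heis w y) =
  heis (oadd z w) (osub (oadd x y) (omul (oconj z) w)).
Proof. by rewrite /heis /mmul /dot; congr Mat; rewrite ?oconjD; ring. Qed.

Lemma heis_star z x : mstar (heis z x) = heis (oopp z) (oconj x).
Proof.
by rewrite /heis /mstar /mconj /= !oconjN !oconjK oconj0 oconj1; congr Mat; ring.
Qed.

Lemma heis00 : heis ozero ozero = mone.
Proof. by rewrite /heis oconj0 /mone; congr Mat; ring. Qed.

(** The vector (x, z, 1), into which [heis z x] maps the isotropic (0, 0, 1), has to be isotropic;
this makes [heis z x] unitary. *)
Definition heis_ok z x : Prop := otrace x = - onorm z.

Lemma heis_inv z x :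
  heis_ok z x -> mmul (mstar (heis z x)) (heis z x) = mone.
Proof.
rewrite /heis_ok => h; rewrite heis_star heisM -heis00; congr heis.
  by ring.
rewrite oconjN; apply: oint_eq.
  cbv [osub oadd omul oopp oconj ozero]; cbn [fst snd].
  move: h; rewrite /otrace /onorm; cbn [fst snd]; lia.
by cbv [osub oadd omul oopp oconj ozero]; cbn [fst snd]; ring.
Qed.

Lemma heis_okN z x : heis_ok z x -> heis_ok (oopp z) (oconj x).
Proof.
by rewrite /heis_ok /otrace /onorm /oconj /oopp; cbn [fst snd]; lia.
Qed.

Lemma heis_okD z x w y : heis_ok z x -> heis_ok w y ->
  heis_ok (oadd z w) (osub (oadd x y) (omul (oconj z) w)).
Proof.
rewrite /heis_ok /otrace /onorm /osub /oadd /omul /oconj; cbn [fst snd]; lia.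
Qed.

Lemma unitary_heis z x : heis_ok z x -> unitary (heis z x).
Proof.
move=> h; split; first exact: heis_inv.
have := heis_inv (heis_okN h).
by rewrite -heis_star mstarK.
Qed.

Lemma mdiagM x y : mmul (mdiag x) (mdiag y) = mdiag (omul x y).
Proof. by rewrite /mdiag /mmul /dot; congr Mat; ring. Qed.

Section Words.
Variable gens : seq mat.

Inductive word : mat -> Prop :=
| word_one : word mone
| word_step A j : word A -> (j < size gens)%N ->
    word (mmul A (nth mone gens j)).

Lemma word_gen j : (j < size gens)%N -> word (nth mone gens j).
Proof. by move=> hj; rewrite -[nth _ _ _]mmul1; apply: word_step word_one hj. Qed.

Lemma wordM A B : word A -> word B -> word (mmul A B).
Proof.
move=> wA wB; elim: wB => [|C j _ IH hj]; first by rewrite mmulm1.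
by rewrite mmulA; apply: word_step.
Qed.
End Words.

Lemma near_multiple (a m : Z) : 0 < m -> exists k, Z.abs (2 * (a + k * m)) <= m.
Proof.
move=> hm; exists (- ((2 * a + m) / (2 * m))).
have := Z_div_mod_eq_full (2 * a + m) (2 * m).
have := Z.mod_pos_bound (2 * a + m) (2 * m).
move: (_ / _) (_ mod _) => q r; nia.
Qed.

(** * Covering a box of the Heisenberg group by Cygan balls *)

(** Real coordinates are rescaled by this factor, so that boxes with integral centres and radii
can be halved repeatedly. *)
Definition grid : Z := 1024.

(** An isotropic vector v with v3 <> 0 has three real coordinates: the two coordinates of v2 / v3
in the basis 1, w, and the second coordinate of v1 / v3; the first coordinate of v1 / v3 is
determined by isotropy. Centre and radius of an interval are given for each. *)
Record box := Box { bx : Z; bxr : Z; by_ : Z; byr : Z; bt : Z; btr : Z }.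

(** The coordinates are the fractions p / m, q / m, t / m with m = |v3|^2, with denominators
cleared. *)
Definition in_box (b : box) (m p q t : Z) : Prop :=
  [/\ Z.abs (grid * p - bx b * m) <= bxr b * m,
      Z.abs (grid * q - by_ b * m) <= byr b * m &
      Z.abs (grid * t - bt b * m) <= btr b * m].

Definition bound_affine (b : box) (a1 a2 a3 a4 : Z) : Z :=
  Z.abs (a1 * bx b + a2 * by_ b + a3 * bt b + a4 * grid)
  + Z.abs a1 * bxr b + Z.abs a2 * byr b + Z.abs a3 * btr b.

Lemma bound_affineP b a1 a2 a3 a4 m p q t : 0 < m -> in_box b m p q t ->
  Z.abs (grid * (a1 * p + a2 * q + a3 * t + a4 * m)) <=
  bound_affine b a1 a2 a3 a4 * m.
Proof.
move=> hm [h1 h2 h3]; rewrite /bound_affine.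
set c := _ + _ + _ + a4 * grid.
have e : grid * (a1 * p + a2 * q + a3 * t + a4 * m) =
  c * m + (a1 * (grid * p - bx b * m) + a2 * (grid * q - by_ b * m)
           + a3 * (grid * t - bt b * m)) by rewrite /c; ring.
have k1 := Z.mul_le_mono_nonneg_l _ _ _ (Z.abs_nonneg a1) h1.
have k2 := Z.mul_le_mono_nonneg_l _ _ _ (Z.abs_nonneg a2) h2.
have k3 := Z.mul_le_mono_nonneg_l _ _ _ (Z.abs_nonneg a3) h3.
move: k1 k2 k3; rewrite -!Z.abs_mul e => k1 k2 k3.
have k4 : Z.abs (c * m) = Z.abs c * m by rewrite Z.abs_mul (Z.abs_eq m); lia.
lia.
Qed.

Definition discr := 4 * N - T * T.

(** Let r = |<v, u>|^2, m = |v3|^2, n = |u3|^2, and E = <v, u> u3 v3^-, so that |E|^2 = r m n.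
As u and v are isotropic, the trace of E is - m n |v2 / v3 - u2 / u3|^2. Writing |E|^2 through its
trace and its second coordinate turns r < m into an inequality that is quartic in the
displacement (X, Y) of v2 / v3 and quadratic in H, which is a Cygan ball. It is monotone in |X|,
|Y| and |H|, so evaluating it at upper bounds proves it on a whole box. *)
Definition ball_test (n X Y H : Z) : bool :=
  (X * X + discr * (Y * Y)) * (X * X + discr * (Y * Y))
    + 16 * discr * (n * n) * (H * H) * (grid * grid)
  <? 64 * (n * n * n) * (grid * grid * (grid * grid)).

(** X, Y and H are affine in the coordinates of v. Their bounds are computed on whole expressions,
which makes them sharp: bounding the terms separately would lose the correlation between v2 and
the shear term of H. *)
Definition ball_covers (b : box) (n : Z) (c w k : oint) : bool :=
  ball_test n (bound_affine b (2 * n) (T * n) 0 (- otrace c))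
    (bound_affine b 0 n 0 (- c.2))
    (bound_affine b w.2 (w.1 + T * w.2) n k.2).

Definition covered_by (b : box) (u1 u2 u3 : oint) : bool :=
  ball_covers b (onorm u3) (omul u2 (oconj u3)) (omul (oconj u2) u3)
    (omul (oconj u1) u3).

Hypothesis discr_gt0 : 0 < 4 * N - T * T.

Lemma onorm_ge0 x : 0 <= onorm x.
Proof.
have : 4 * onorm x = otrace x * otrace x + (4 * N - T * T) * (x.2 * x.2).
  by rewrite /onorm /otrace; ring.
nia.
Qed.

Lemma sq_le a b : Z.abs a <= b -> a * a <= b * b.
Proof. nia. Qed.

(** The inequality behind [ball_test]: the bounds bX, bY, bH hold after scaling by G = grid^2, a
and b are the trace and the second coordinate of E. *)
Lemma ball_arith (D n m G X Y a b r bX bY bH : Z) :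
  0 <= D -> 0 < n -> 0 < m -> 0 < G ->
  G * (X * X) <= bX * bX * (m * m) ->
  G * (Y * Y) <= bY * bY * (m * m) ->
  G * (b * b) <= bH * bH * (m * m) ->
  (bX * bX + D * (bY * bY)) * (bX * bX + D * (bY * bY))
    + 16 * D * (n * n) * (bH * bH) * G < 64 * (n * n * n) * (G * G) ->
  4 * (m * n) * a = - (X * X + D * (Y * Y)) ->
  4 * (r * (m * n)) = a * a + D * (b * b) ->
  r < m.
Proof.
move=> hd n0 hm G0 hX hY hH; set K := bX * bX + _ => hc E1 NE'.
have hS : G * (X * X + D * (Y * Y)) <= K * (m * m).
  have := Z.mul_le_mono_nonneg_l _ _ _ hd hY; rewrite /K; lia.
have S0 : 0 <= X * X + D * (Y * Y).
  by have := Z.square_nonneg X; have := Z.mul_nonneg_nonneg _ _ hd (Z.square_nonneg Y); lia.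
move: hS S0 E1; set S := X * X + _ => hS S0 E1.
have hS2 : (G * S) * (G * S) <= (K * (m * m)) * (K * (m * m)).
  by apply: Z.square_le_mono_nonneg => //; nia.
have hA : 16 * (n * n) * (G * G) * (a * a) <= K * K * (m * m).
  have mm0 : 0 < m * m by nia.
  apply/(Z.mul_le_mono_pos_r _ _ _ mm0).
  have -> : 16 * (n * n) * (G * G) * (a * a) * (m * m) =
    G * G * ((4 * (m * n) * a) * (4 * (m * n) * a)) by ring.
  by rewrite E1; lia.
have hB : 16 * (n * n) * (G * G) * (D * (b * b)) <=
   16 * D * (n * n) * (bH * bH) * G * (m * m).
  have -> : 16 * (n * n) * (G * G) * (D * (b * b)) =
    (16 * D * (n * n) * G) * (G * (b * b)) by ring.
  have -> : 16 * D * (n * n) * (bH * bH) * G * (m * m) =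
    (16 * D * (n * n) * G) * (bH * bH * (m * m)) by ring.
  by apply: Z.mul_le_mono_nonneg_l => //; nia.
have hC : 16 * (n * n) * (G * G) * (4 * (r * (m * n))) <
  64 * (n * n * n) * (G * G) * (m * m).
  rewrite NE'.
  have mm0 : 0 < m * m by nia.
  move/(Z.mul_lt_mono_pos_r _ _ _ mm0): hc; lia.
have {}hC : (64 * (n * n * n) * (G * G) * m) * r <
  (64 * (n * n * n) * (G * G) * m) * m by lia.
have p0 : 0 < 64 * (n * n * n) * (G * G) * m by nia.
exact/(Z.mul_lt_mono_pos_l _ _ _ p0).
Qed.

Lemma ball_coversP b n m c w k z t E r :
  0 < m -> 0 <= n -> in_box b m z.1 z.2 t ->
  E.2 = w.2 * z.1 + (w.1 + T * w.2) * z.2 + n * t + k.2 * m ->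
  (let X := 2 * n * z.1 + T * n * z.2 + 0 * t + - otrace c * m in
   let Y := 0 * z.1 + n * z.2 + 0 * t + - c.2 * m in
   4 * (m * n) * otrace E = - (X * X + discr * (Y * Y))) ->
  onorm E = r * (m * n) ->
  ball_covers b n c w k -> r < m.
Proof.
move=> hm n0 hb E2 E1 NE.
have hX := bound_affineP (a1 := 2 * n) (a2 := T * n) (a3 := 0) (a4 := - otrace c) hm hb.
have hY := bound_affineP (a1 := 0) (a2 := n) (a3 := 0) (a4 := - c.2) hm hb.
have hH := bound_affineP (a1 := w.2) (a2 := w.1 + T * w.2) (a3 := n) (a4 := k.2) hm hb.
have NE' : 4 * onorm E = otrace E * otrace E + discr * (E.2 * E.2).
  by rewrite /discr; cbv [otrace onorm]; ring.
rewrite /ball_covers; rewrite -E2 in hH; rewrite NE in NE'.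
move: E1 hX hY hH NE'; cbv zeta.
move: (bound_affine _ _ _ _ _) (bound_affine _ _ _ _ _) (bound_affine _ _ _ _ _).
move: (otrace E) E.2 => a b'.
move: (_ + - otrace c * m) (_ + - c.2 * m) => X Y bH bY bX E1.
move=> /sq_le hX /sq_le hY /sq_le hH NE' /Z.ltb_lt hc.
have hd : 0 <= discr by rewrite /discr; lia.
have n1 : 0 < n.
  case: (Z.eq_dec n 0) => n2; last by lia.
  have := Z.square_nonneg (bX * bX + discr * (bY * bY)).
  by move: hc; rewrite n2; lia.
apply: (@ball_arith discr n m (grid * grid) X Y a b' r bX bY bH) => //; lia.
Qed.

Lemma covered_byP b (u1 u2 u3 v1 v2 v3 : oint) :
  otrace (omul u1 (oconj u3)) = - onorm u2 ->
  otrace (omul v1 (oconj v3)) = - onorm v2 ->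
  0 < onorm v3 ->
  in_box b (onorm v3) (omul v2 (oconj v3)).1 (omul v2 (oconj v3)).2
    (omul v1 (oconj v3)).2 ->
  covered_by b u1 u2 u3 ->
  onorm (dot v1 v2 v3 (oconj u3) (oconj u2) (oconj u1)) < onorm v3.
Proof.
move=> hu hv hm hb; set e := dot _ _ _ _ _ _.
apply: (ball_coversP (E := omul e (omul (oconj v3) u3)) hm _ hb).
- exact: onorm_ge0.
- rewrite /e /dot.
  by cbv [omul oadd oconj onorm]; cbn [fst snd]; ring.
- set w := omul (oconj u2) u3.
  have -> : otrace (omul e (omul (oconj v3) u3)) =
    onorm u3 * otrace (omul v1 (oconj v3))
    + otrace (omul (omul v2 (oconj v3)) w)
    + onorm v3 * otrace (omul u1 (oconj u3)).
    rewrite /e /w /dot.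
    by cbv [otrace omul oadd oconj onorm]; cbn [fst snd]; ring.
  rewrite hu hv /w /discr; cbv [otrace omul oadd oconj onorm].
  by cbn [fst snd]; ring.
- by rewrite !onormM onorm_conj.
Qed.

Lemma onorm_eq0 x : onorm x = 0 -> x = ozero.
Proof.
have : 4 * onorm x = otrace x * otrace x + (4 * N - T * T) * (x.2 * x.2).
  by rewrite /onorm /otrace; ring.
move=> e h; have h2 : x.2 = 0 by nia.
apply: oint_eq => //; rewrite /ozero; cbn [fst].
by move: e; rewrite h /otrace h2; nia.
Qed.

Definition halve (b : box) : box * box :=
  let: Box x xr y yr t tr := b in
  if (yr <=? xr) && (tr <=? xr) then
    let h := xr / 2 in (Box (x - h) h y yr t tr, Box (x + h) h y yr t tr)
  else if tr <=? yr then
    let h := yr / 2 in (Box x xr (y - h) h t tr, Box x xr (y + h) h t tr)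
  else
    let h := tr / 2 in (Box x xr y yr (t - h) h, Box x xr y yr (t + h) h).

Definition even_box (b : box) : bool :=
  [&& Z.even (bxr b), Z.even (byr b) & Z.even (btr b)].

Lemma halve_interval (c r m a : Z) : Z.even r -> 0 < m ->
  Z.abs (a - c * m) <= r * m ->
  Z.abs (a - (c - r / 2) * m) <= r / 2 * m \/
  Z.abs (a - (c + r / 2) * m) <= r / 2 * m.
Proof.
move=> /Zeven_bool_iff /Zeven_div2; rewrite Z.div2_div => e hm; rewrite {1}e; nia.
Qed.

Lemma halveP b m p q t : 0 < m -> even_box b -> in_box b m p q t ->
  in_box (halve b).1 m p q t \/ in_box (halve b).2 m p q t.
Proof.
case: b => x xr y yr u ur hm; rewrite /even_box /= => /and3P[ex ey et].
case; rewrite /halve /= => hx hy ht.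
case: ifP => _ /=; last case: ifP => _ /=.
- by case: (halve_interval ex hm hx) => h; [left|right].
- by case: (halve_interval ey hm hy) => h; [left|right].
- by case: (halve_interval et hm ht) => h; [left|right].
Qed.

(** The matrices stand for the balls of their first columns. *)
Fixpoint covers (fuel : nat) (Ms : seq mat) (b : box) : bool :=
  if has (fun M => covered_by b (m11 M) (m21 M) (m31 M)) Ms then true
  else if fuel is n.+1 then
    [&& even_box b, covers n Ms (halve b).1 & covers n Ms (halve b).2]
  else false.

Lemma coversP fuel Ms b m p q t : 0 < m -> in_box b m p q t ->
  covers fuel Ms b ->
  exists2 b', in_box b' m p q t &
    has (fun M => covered_by b' (m11 M) (m21 M) (m31 M)) Ms.
Proof.
move=> hm; elim: fuel b => [|n IH] b hb /=; case: ifP => // hM; try by exists b.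
case/and3P=> he h1 h2.
by case: (halveP hm he hb) => h; [apply: IH h1|apply: IH h2].
Qed.

Hypothesis TN : T = 1 \/ T = 0 /\ (N = 1 \/ N = 2).

(** For T = 0 the norm of z must be even, which for N = 1 means z.1 = z.2 mod 2 and for N = 2
means that z.1 is even; for T = 1 every z is admissible. *)
Definition xstep := 2 - T.
Definition xshear := (1 - T) * (2 - N).
Definition tstep := 1 + T.
Definition cusp_box : box := Box 0 (512 * xstep) 0 512 0 (512 * tstep).

Lemma heis_exists b j :
  exists x, heis_ok (xshear * b + xstep * j, b) x.
Proof.
case: TN => [eT|[eT [] eN]].
- set z := (_, b); pose c := (onorm z + 1) / 2; exists (- c, 2 * c - onorm z).
  by rewrite /heis_ok /otrace; cbn [fst snd]; rewrite eT; lia.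
- exists (- (b * b + 2 * b * j + 2 * j * j), 0).
  rewrite /heis_ok /otrace /onorm /xshear /xstep; cbn [fst snd].
  by rewrite eT eN; lia.
- exists (- (b * b + 2 * j * j), 0).
  rewrite /heis_ok /otrace /onorm /xshear /xstep; cbn [fst snd].
  by rewrite eT eN; lia.
Qed.

(** The elements of trace 0, which are the central translations. *)
Definition vert (j : Z) : oint := (- T * j, tstep * j).

Lemma vert_ok z x j : heis_ok z x -> heis_ok z (oadd x (vert j)).
Proof.
rewrite /heis_ok /vert /otrace /oadd /tstep; cbn [fst snd].
case: TN => [->|[-> _]]; lia.
Qed.

(** A translation [heis z x] adds z to v2 / v3. The admissible z form a lattice with basis
(xstep, 0), (xshear, 1), and the admissible x for a fixed z differ by multiples of (- T, tstep); so
the three coordinates can be reduced in the order v2.2, v2.1, v1.2, each to half a period. *)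
Lemma to_cusp_box (v1 v2 v3 : oint) : 0 < onorm v3 ->
  exists z x, heis_ok z x /\
   in_box cusp_box (onorm v3)
     (omul (oadd v2 (omul z v3)) (oconj v3)).1
     (omul (oadd v2 (omul z v3)) (oconj v3)).2
     (omul (dot oone (oopp (oconj z)) x v1 v2 v3) (oconj v3)).2.
Proof.
set m := onorm v3 => hm.
set w := omul v2 (oconj v3).
have [b hb] := near_multiple w.2 hm.
have hm2 : 0 < xstep * m by rewrite /xstep; case: TN => [->|[-> _]]; lia.
have [j hj] := near_multiple (w.1 + xshear * b * m) hm2.
set z : oint := (xshear * b + xstep * j, b).
have [x0 hx0] := heis_exists b j; rewrite -/z in hx0.
have hm3 : 0 < tstep * m by rewrite /tstep; case: TN => [->|[-> _]]; lia.
set a := (omul (dot oone (oopp (oconj z)) x0 v1 v2 v3) (oconj v3)).2.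
have [k hk] := near_multiple a hm3.
exists z, (oadd x0 (vert k)); split; first exact: vert_ok.
have e : omul (oadd v2 (omul z v3)) (oconj v3) = oadd w (omul z (m, 0)).
  by rewrite /m -onormE /w; ring.
have e2 : (omul (dot oone (oopp (oconj z)) (oadd x0 (vert k)) v1 v2 v3)
            (oconj v3)).2 = a + tstep * k * m.
  have -> : omul (dot oone (oopp (oconj z)) (oadd x0 (vert k)) v1 v2 v3)
              (oconj v3) =
    oadd (omul (dot oone (oopp (oconj z)) x0 v1 v2 v3) (oconj v3))
         (omul (vert k) (m, 0)).
    by rewrite /m -onormE /dot; ring.
  rewrite /a; move: (omul (dot oone _ x0 v1 v2 v3) _) => y.
  by rewrite /oadd /omul /vert; cbn [fst snd]; ring.
rewrite e e2; move: hb hj hk; rewrite /in_box /z /cusp_box /grid.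
rewrite -/m -/w; clearbody a w m; clear e e2 hx0 z.
move: xshear xstep tstep hm2 hm3 => r0 s0 t0 hm2 hm3.
by cbv [oadd omul bx bxr by_ byr bt btr]; cbn [fst snd] => hb hj hk; split; lia.
Qed.

(** * Generators of U(2,1,O_d) *)
Section Generation.
Variables (eps : oint) (bases : seq mat) (cov : seq (oint * oint * nat * nat)).

Definition xgen := heis (xstep, 0) (- xstep, T).
Definition ygen :=
  let n := onorm (xshear, 1) in
  let c := (n + 1) / 2 in heis (xshear, 1) (- c, T * (2 * c - n)).

(** The element of index 5 is scalar; the other elements before [bases] generate, with it, the
stabilizer of the cusp. *)
Definition gens : seq mat :=
  [:: xgen, ygen, heis ozero (vert 1), heis ozero (vert (-1)),
      mdiag eps, smat eps mone & bases].

Definition opow (k : nat) : oint := iter k (omul eps) oone.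

(** A ball of the covering is given by a word in the generators, written as a translation, a power
of [eps] in the middle entry, and one of the base matrices. *)
Definition cov_mat (e : oint * oint * nat * nat) : mat :=
  let: (z, x, k, i) := e in
  mmul (heis z x) (mmul (mdiag (opow k)) (nth mone bases i)).

Definition cov_ok (e : oint * oint * nat * nat) : bool :=
  let: (z, x, k, i) := e in
  (otrace x =? - onorm z) && (i < size bases)%N.

Hypothesis units_eps : forall x, onorm x = 1 -> exists k, x = opow k.
Hypothesis gens_unitary : all unitaryb gens.
Hypothesis cov_okP : all cov_ok cov.
Variable fuel : nat.
Hypothesis cov_covers : covers fuel [seq cov_mat e | e <- cov] cusp_box.

Lemma word_unitary A : word gens A -> unitary A.
Proof.
elim=> [|{}A j _ IH hj]; first exact: unitary1.
apply: unitaryM => //; apply: unitarybP.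
exact: (all_nthP mone gens_unitary).
Qed.

Lemma word_eps_scale k : word gens (smat (opow k) mone).
Proof.
elim: k => [|k IH]; first by rewrite smat1; apply: word_one.
have -> : smat (opow k.+1) mone = mmul (smat (opow k) mone) (smat eps mone).
  by rewrite smatr smatl mmul1 smatA.
by apply: (wordM IH); apply: (@word_gen gens 5).
Qed.

Lemma word_scale u A : onorm u = 1 -> word gens A -> word gens (smat u A).
Proof.
move=> /units_eps [k ->] wA; rewrite smatE; apply: (wordM wA).
exact: word_eps_scale.
Qed.

Lemma word_eps_diag k : word gens (mdiag (opow k)).
Proof.
elim: k => [|k IH]; first exact: word_one.
have -> : mdiag (opow k.+1) = mmul (mdiag eps) (mdiag (opow k)) by rewrite mdiagM.
by apply: wordM IH; apply: (@word_gen gens 4).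
Qed.

Lemma word_diag u : onorm u = 1 -> word gens (mdiag u).
Proof. by move=> /units_eps [k ->]; apply: word_eps_diag. Qed.

Lemma word_vert j : word gens (heis ozero (vert j)).
Proof.
have vD i k : heis ozero (vert (i + k)) = mmul (heis ozero (vert i)) (heis ozero (vert k)).
  rewrite heisM; congr heis.
  by rewrite oconj0 /vert; apply: oint_eq; cbv [oadd osub omul ozero]; cbn [fst snd]; ring.
have v0 : heis ozero (vert 0) = mone.
  rewrite -heis00; congr heis.
  by apply: oint_eq; rewrite /vert /ozero; cbn [fst snd]; ring.
elim/Z.peano_ind: j => [|j IH|j IH].
- by rewrite v0; apply: word_one.
- by rewrite -Z.add_1_r vD; apply: (wordM IH); apply: (@word_gen gens 2).
- by rewrite -Z.sub_1_r vD; apply: (wordM IH); apply: (@word_gen gens 3).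
Qed.

Lemma heis_okB z x y : heis_ok z x -> heis_ok z y -> exists j, y = oadd x (vert j).
Proof.
rewrite /heis_ok /otrace /vert /tstep; case: x => x1 x2; case: y => y1 y2.
cbn [fst snd] => hx hy; case: TN => [eT|[eT _]].
- exists (x1 - y1); rewrite eT in hx hy *; apply: oint_eq; rewrite /oadd; cbn [fst snd]; lia.
- exists (y2 - x2); rewrite eT in hx hy *; apply: oint_eq; rewrite /oadd; cbn [fst snd]; lia.
Qed.

Lemma word_heis_irr z x y :
  heis_ok z x -> heis_ok z y -> word gens (heis z x) -> word gens (heis z y).
Proof.
move=> hx hy; have [j ->] := heis_okB hx hy => w.
have -> : heis z (oadd x (vert j)) = mmul (heis z x) (heis ozero (vert j)).
  by rewrite heisM; congr heis; ring.
exact: wordM (word_vert j).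
Qed.

(** As the centre consists of words, membership of [heis z x] depends on z alone. *)
Definition word_trans z := exists2 x, heis_ok z x & word gens (heis z x).

Lemma word_transD z w : word_trans z -> word_trans w -> word_trans (oadd z w).
Proof.
move=> [x hx wx] [y hy wy].
exists (osub (oadd x y) (omul (oconj z) w)); first exact: heis_okD.
by rewrite -heisM; apply: wordM.
Qed.

Lemma word_transN z : word_trans z -> word_trans (oopp z).
Proof.
move=> [x hx wx]; exists x.
  by move: hx; rewrite /heis_ok /onorm /oopp; cbn [fst snd]; lia.
have -> : heis (oopp z) x = mmul (mdiag (oopp oone)) (mmul (heis z x) (mdiag (oopp oone))).
  by rewrite /heis /mdiag /mmul /dot; congr Mat; rewrite ?oconjN; ring.
have wd : word gens (mdiag (oopp oone)).
  by apply: word_diag; rewrite /onorm /oopp /oone; cbn [fst snd]; ring.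
exact: wordM wd (wordM wx wd).
Qed.

Lemma word_transZ z (k : Z) : word_trans z -> word_trans (k * z.1, k * z.2).
Proof.
move=> hz; elim/Z.peano_ind: k => [|k IH|k IH].
- exists ozero; first by rewrite /heis_ok /otrace /onorm /ozero; cbn [fst snd]; lia.
  have -> : (0 * z.1, 0 * z.2) = ozero by [].
  by rewrite heis00; apply: word_one.
- have -> : (Z.succ k * z.1, Z.succ k * z.2) = oadd (k * z.1, k * z.2) z.
    by apply: oint_eq; rewrite /oadd; cbn [fst snd]; lia.
  exact: word_transD.
- have -> : (Z.pred k * z.1, Z.pred k * z.2) = oadd (k * z.1, k * z.2) (oopp z).
    by apply: oint_eq; rewrite /oadd /oopp; cbn [fst snd]; lia.
  by apply: word_transD (word_transN hz).
Qed.

Lemma word_heis z x : heis_ok z x -> word gens (heis z x).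
Proof.
move=> hx.
have [j ej] : exists j, z = (xshear * z.2 + xstep * j, z.2).
  suff [j hj] : exists j, z.1 = xshear * z.2 + xstep * j.
    by exists j; apply: oint_eq.
  move: hx; rewrite /heis_ok /otrace /onorm /xshear /xstep.
  case: TN => [->|[-> [] ->]].
  - by exists (z.1); lia.
  - move=> h; exists ((z.1 - z.2) / 2).
    have := Z_div_mod_eq_full (z.1 - z.2) 2; have := Z.mod_pos_bound (z.1 - z.2) 2.
    move: (_ / _) (_ mod _) => q r; nia.
  - move=> h; exists (z.1 / 2).
    have := Z_div_mod_eq_full z.1 2; have := Z.mod_pos_bound z.1 2.
    move: (_ / _) (_ mod _) => q r; nia.
have [y hy wy] : word_trans z.
  have hX : word_trans (xstep, 0).
    exists (- xstep, T); last exact: (@word_gen gens 0).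
    rewrite /heis_ok /otrace /onorm /xstep; cbn [fst snd].
    by case: TN => [->|[-> _]]; lia.
  have hY : word_trans (xshear, 1).
    exists (let n := onorm (xshear, 1) in
      let c := (n + 1) / 2 in (- c, T * (2 * c - n))); last exact: (@word_gen gens 1).
    rewrite /heis_ok /otrace; cbn [fst snd].
    set n := onorm _; set c := _ / 2.
    suff : T = 1 \/ T = 0 /\ 2 * c = n by case=> [->|[-> ]]; lia.
    rewrite /c /n /onorm /xshear; cbn [fst snd].
    by case: TN => [->|[-> [] ->]]; [left|right|right].
  have -> : z = oadd (j * xstep, j * 0) (z.2 * xshear, z.2 * 1).
    by rewrite {1}ej; apply: oint_eq; rewrite /oadd; cbn [fst snd]; ring.
  by apply: word_transD; [apply: (word_transZ j hX)|apply: (word_transZ z.2 hY)].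
exact: word_heis_irr hy hx wy.
Qed.

(** The first column of a unitary matrix is isotropic, as (1, 0, 0) is. *)
Lemma unitary_null A : unitary A ->
  otrace (omul (m11 A) (oconj (m31 A))) = - onorm (m21 A).
Proof.
case: A => a b c d e f g h i [eA _].
have := congr1 (fun M => (m31 M).1) eA.
cbv [mmul mstar mconj mmap mone dot m11 m21 m31].
by cbv [otrace onorm omul oadd oconj ozero]; cbn [fst snd]; lia.
Qed.

Lemma omul_eq0 x y : onorm x = 1 -> omul x y = ozero -> y = ozero.
Proof.
move=> hx h; apply: onorm_eq0.
by have := onormM x y; rewrite h hx Z.mul_1_l => <-; rewrite /onorm /=; ring.
Qed.

(** If the lower left entry vanishes, isotropy forces the first column to be (a, 0, 0), and then
unitarity makes the matrix upper triangular: a unit times a translation times a diagonal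
matrix. *)
Lemma word_cusp A : unitary A -> m31 A = ozero -> word gens A.
Proof.
move=> uA h31; have h21 : m21 A = ozero.
  apply: onorm_eq0; have := unitary_null uA; rewrite h31 oconj0.
  by rewrite /otrace /omul /ozero; cbn [fst snd]; lia.
case: A h31 h21 uA => a b c d e f g h i /= -> -> uA.
have := proj1 uA; set S := mmul _ _ => eS.
have e11 := congr1 m11 eS; have e12 := congr1 m12 eS.
have e13 := congr1 m13 eS; have e21 := congr1 m21 eS; have e22 := congr1 m22 eS.
move: e11 e12 e13 e21 e22; rewrite /S; clear S eS.
cbv [mmul mstar mconj mmap mone dot m11 m12 m13 m21 m22].
move=> e11 e12 e13 e21 e22.
have hia : omul (oconj i) a = oone by rewrite -e11; ring.
have hne : onorm a = 1.
  have : onorm (omul (oconj i) a) = 1 by rewrite hia onorm1.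
  by rewrite onormM => /(Z.eq_mul_1_nonneg _ _ (@onorm_ge0 (oconj i))) [].
have hea : omul a (oconj a) = oone by rewrite onormE hne.
have ei : i = a.
  rewrite -(oconjK i) -(oconjK a); congr oconj.
  have -> : oconj i = omul (omul (oconj i) a) (oconj a).
    have -> : omul (omul (oconj i) a) (oconj a) = omul (oconj i) (omul a (oconj a)) by ring.
    by rewrite hea; ring.
  by rewrite hia; ring.
have h0 : h = ozero.
  rewrite -[h]oconjK; have -> : oconj h = ozero; last exact: oconj0.
  by apply: (omul_eq0 hne); rewrite -e21; ring.
rewrite h0 oconj0 in e12 e22; rewrite ei in e12 e13.
have he : onorm e = 1.
  have := congr1 (fun y : oint => y.1) e22.
  by cbv [onorm omul oadd oconj ozero oone]; cbn [fst snd]; lia.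
have hb : b = oopp (omul a (omul (oconj f) e)).
  have -> : b = omul (omul a (oconj a)) b by rewrite hea; ring.
  have -> : omul (omul a (oconj a)) b =
    oadd (omul a (oadd (omul (oconj a) b) (oadd (omul (oconj f) e) (omul (oconj c) ozero))))
         (oopp (omul a (omul (oconj f) e))) by ring.
  by rewrite e12; ring.
set z := omul (oconj a) f; set x := omul (oconj a) c.
have hzx : heis_ok z x.
  rewrite /heis_ok /z onormM onorm_conj hne Z.mul_1_l.
  have := congr1 (fun y : oint => y.1) e13.
  by cbv [x otrace onorm omul oadd oconj ozero]; cbn [fst snd]; lia.
have -> : Mat a b c ozero e f ozero h i =
    smat a (mmul (heis z x) (mdiag (omul (oconj a) e))).
  have aK y : omul a (omul (oconj a) y) = y.
    have -> : omul a (omul (oconj a) y) = omul (omul a (oconj a)) y by ring.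
    by rewrite hea; ring.
  rewrite hb ei h0 /z /x /heis /mdiag /smat /mmul /dot /=.
  rewrite oconjM oconjK; congr Mat; try by ring.
  - have -> : omul a
      (oadd (omul oone ozero)
       (oadd (omul (oopp (omul a (oconj f))) (omul (oconj a) e))
         (omul (omul (oconj a) c) ozero))) =
      oopp (omul a (omul (oconj a) (omul a (omul (oconj f) e)))) by ring.
    by rewrite aK.
  - by rewrite -[in LHS](aK c); ring.
  - by rewrite -[in LHS](aK e); ring.
  - by rewrite -[in LHS](aK f); ring.
apply: word_scale => //; apply: wordM; first exact: word_heis.
by apply: word_diag; rewrite onormM onorm_conj hne he.
Qed.

(** Descent on the norm of the lower left entry, which for M^* A is <v, u>, where v and u are the
first columns of A and M. *)
Theorem unitary_word A : unitary A -> word gens A.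
Proof.
have [n] := ubnP (Z.to_nat (onorm (m31 A))); elim: n A => // n IH A hn uA.
case: (Z.eq_dec (onorm (m31 A)) 0) => [/onorm_eq0|n0]; first exact: word_cusp.
have hm : 0 < onorm (m31 A) by have := @onorm_ge0 (m31 A); lia.
have [z [x [hx hb]]] := to_cusp_box (m11 A) (m21 A) hm.
have [b {}hb] := coversP hm hb cov_covers.
rewrite has_map => /(has_nthP (ozero, ozero, 0%N, 0%N)) [k hk].
have := all_nthP (ozero, ozero, 0%N, 0%N) cov_okP _ hk.
rewrite /preim /=; case: (nth _ _ _) => [[[y y'] l] i] /andP[/Z.eqb_eq ok1 ok2].
set M := cov_mat _ => hc.
have wM : word gens M.
  apply: wordM; first exact: word_heis.
  by apply: wordM (word_eps_diag l) (@word_gen gens (6 + i) _).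
have uM := word_unitary wM.
have uH := unitary_heis hx.
set A1 := mmul (heis z x) A.
have u1 : unitary A1 by apply: unitaryM.
have e31 : m31 A1 = m31 A.
  by rewrite /A1; case: (A) => *; rewrite /mmul /heis /dot /=; ring.
have e21 : m21 A1 = oadd (m21 A) (omul z (m31 A)).
  by rewrite /A1; case: (A) => *; rewrite /mmul /heis /dot /=; ring.
have e11 : m11 A1 = dot oone (oopp (oconj z)) x (m11 A) (m21 A) (m31 A).
  by rewrite /A1; case: (A) => *; rewrite /mmul /heis /dot /=; ring.
rewrite -e11 -e21 -e31 in hb.
have hlt : onorm (m31 (mmul (mstar M) A1)) < onorm (m31 A).
  have -> : m31 (mmul (mstar M) A1) =
    dot (m11 A1) (m21 A1) (m31 A1) (oconj (m31 M)) (oconj (m21 M)) (oconj (m11 M)).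
    by case: (M) => *; case: (A1) => *; rewrite /mmul /mstar /mconj /dot /=; ring.
  rewrite -e31; apply: (covered_byP _ _ _ hb hc); last by rewrite e31.
    exact: unitary_null uM.
  exact: unitary_null u1.
have w2 : word gens (mmul (mstar M) A1).
  apply: IH; last exact: unitaryM (unitary_star uM) u1.
  move/ltP: hn => hn; apply/ltP.
  by have := @onorm_ge0 (m31 (mmul (mstar M) A1)); lia.
have -> : A = mmul (mstar (heis z x)) (mmul M (mmul (mstar M) A1)).
  by rewrite (mmulA M) (proj2 uM) mmul1 /A1 mmulA (proj1 uH) mmul1.
apply: wordM (wordM wM w2).
by rewrite heis_star; apply: word_heis; apply: heis_okN.
Qed.

End Generation.

Lemma opowD eps k l : omul (opow eps k) (opow eps l) = opow eps (k + l).
Proof.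
rewrite /opow iterD; move: (iter l _ _) => x.
elim: k => [|k IH] /=; first by ring.
by rewrite -IH; ring.
Qed.

(** * Cosets of a congruence subgroup *)

(** Residues modulo the subgroup of O_d spanned by (a, 0) and (b, c), which [ideal_ok] checks to be
an ideal. *)
Section Reduction.
Variables a b c : Z.

Definition red x : oint :=
  let q := x.2 / c in ((x.1 - q * b) mod a, x.2 - q * c).

Definition in_ideal x : Prop := exists i j, x = (i * a + j * b, j * c).

Definition ideal_ok : bool :=
  [&& 0 <? a, 0 <? c, oeqb (red (0, a)) ozero &
      oeqb (red (omul (0, 1) (b, c))) ozero].

Hypothesis idealP : ideal_ok.

Lemma red_in_ideal x : in_ideal (osub x (red x)).
Proof.
exists ((x.1 - x.2 / c * b) / a), (x.2 / c).
have := Z_div_mod_eq_full (x.1 - x.2 / c * b) a.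
rewrite /osub /red; cbn [fst snd] => h.
by apply: oint_eq; cbn [fst snd]; lia.
Qed.

Lemma in_idealD x y : in_ideal x -> in_ideal y -> in_ideal (oadd x y).
Proof.
move=> [i [j ->]] [k [l ->]]; exists (i + k), (j + l).
by rewrite /oadd; cbn [fst snd]; apply: oint_eq; cbn [fst snd]; ring.
Qed.

Lemma in_idealZ k x : in_ideal x -> in_ideal (k * x.1, k * x.2).
Proof.
move=> [i [j ->]]; exists (k * i), (k * j).
by apply: oint_eq; cbn [fst snd]; ring.
Qed.

Lemma red0_in_ideal x : red x = ozero -> in_ideal x.
Proof.
move=> h; have := red_in_ideal x; rewrite h.
by have -> : osub x ozero = x by ring.
Qed.

Lemma in_idealM x y : in_ideal x -> in_ideal (omul x y).
Proof.
have /and4P[_ _ /oeqbP h1 /oeqbP h2] := idealP.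
move: h1 h2 => /red0_in_ideal h1 /red0_in_ideal h2 [i [j ->]].
have -> : omul (i * a + j * b, j * c) y =
  oadd (oadd (y.1 * i * a + y.1 * j * b, y.1 * j * c)
     (y.2 * i * (0, a).1, y.2 * i * (0, a).2))
   (y.2 * j * (omul (0, 1) (b, c)).1, y.2 * j * (omul (0, 1) (b, c)).2).
  by rewrite /omul /oadd; cbn [fst snd]; apply: oint_eq; cbn [fst snd]; ring.
apply: in_idealD (in_idealZ _ h2); apply: in_idealD (in_idealZ _ h1).
by exists (y.1 * i), (y.1 * j).
Qed.

Lemma red_eq x y : in_ideal (osub x y) -> red x = red y.
Proof.
have /and4P[/Z.ltb_lt ha /Z.ltb_lt hc _ _] := idealP.
case: x y => [x1 x2] [y1 y2] [i [j]]; rewrite /osub; cbn [fst snd] => -[e1 e2].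
have -> : x1 = y1 + (i * a + j * b) by lia.
have -> : x2 = y2 + j * c by lia.
rewrite /red; cbn [fst snd]; rewrite Z.div_add; last by lia.
apply: oint_eq; cbn [fst snd]; last by ring.
rewrite -(Z.mod_add (y1 - y2 / c * b) i); last by lia.
by congr (_ mod _); ring.
Qed.

Lemma redM x y : red (omul (red x) y) = red (omul x y).
Proof.
apply/esym/red_eq.
have -> : osub (omul x y) (omul (red x) y) = omul (osub x (red x)) y by ring.
exact/in_idealM/red_in_ideal.
Qed.

Lemma redD x y : red (oadd (red x) (red y)) = red (oadd x y).
Proof.
apply/esym/red_eq.
have -> : osub (oadd x y) (oadd (red x) (red y)) =
  oadd (osub x (red x)) (osub y (red y)) by ring.
exact: in_idealD (red_in_ideal x) (red_in_ideal y).
Qed.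

Definition mred := mmap red.

Lemma red_dot x y z x' y' z' :
  red (dot (red x) (red y) (red z) x' y' z') = red (dot x y z x' y' z').
Proof.
rewrite /dot -[LHS]redD -[in X in oadd _ X]redD !redM.
by rewrite [X in oadd _ X]redD redD.
Qed.

Lemma mredM A B : mred (mmul (mred A) B) = mred (mmul A B).
Proof. by case: A; case: B => *; rewrite /mred /mmul /=; congr Mat; exact: red_dot. Qed.

(** A residue matrix is packed into one number, by octal digits. A collision of keys could only
make a check fail, because the entries of the table carry their matrices, which are compared. *)
Definition digit (k : Z) x : Z := (k * 8 + x.1) * 8 + x.2.
Definition key A : positive :=
  let: Mat x y z x' y' z' x'' y'' z'' := A in
  Z.to_pos (foldl digit 1 [:: x; y; z; x'; y'; z'; x''; y''; z'']).

Definition table := PositiveMap.t (mat * nat).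
Definition lookup (t : table) A : option (mat * nat) := PositiveMap.find (key A) t.

(** [acts] is the right action of the generators [gs] on the coset numbers, [decomp] the words in
the matrices [refls] that certify it. *)
Section Cosets.
Variables (gs reps refls : seq mat) (acts : seq (seq nat)) (eps : oint)
  (decomp : seq (seq (seq (nat * nat)))) (fuel : nat).

Definition act (q j : nat) : nat := nth 0%N (nth [::] acts q) j.

Definition visit (st : seq (mat * nat) * table) (M : mat) (q : nat) (gj : mat * nat) :=
  let M' := mred (mmul M gj.1) in
  if lookup st.2 M' is Some _ then st
  else let e := (M', act q gj.2) in (e :: st.1, PositiveMap.add (key M') e st.2).

(** Graph search from the residue of 1. The label of a new residue is propagated along the edge by
which it is first reached; agreement along the other edges is left to [table_ok]. *)
Fixpoint explore (n : nat) (todo : seq (mat * nat)) (t : table) : table :=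
  match n, todo with
  | n'.+1, (M, q) :: r =>
      let st := foldl (fun st gj => visit st M q gj) (r, t) (zip gs (iota 0 (size gs))) in
      explore n' st.1 st.2
  | _, _ => t
  end.

Definition coset_table : table :=
  let e := (mred mone, 0%N) in
  explore fuel [:: e] (PositiveMap.add (key e.1) e (PositiveMap.empty _)).

Definition agrees (t : table) A (q : nat) : bool :=
  if lookup t A is Some (A', q') then meqb A' A && (q' == q) else false.

(** The table is closed under the generators and its labels follow the action. The scalar
generator, of index 5, must not change the label: only then is it defined on PU(2,1,O_d). *)
Definition table_ok (t : table) : bool :=
  all (fun e : positive * (mat * nat) =>
         let: (M, q) := e.2 in
         [&& (q < size reps)%N, act q 5 == q &
         all (fun gj => agrees t (mred (mmul M gj.1)) (act q gj.2))
           (zip gs (iota 0 (size gs)))])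
    (PositiveMap.elements t).

Definition even_prod (w : seq (nat * nat)) : mat :=
  foldr (fun ij => mmul (mmul (nth mone refls ij.1) (mconj (nth mone refls ij.2))))
    mone w.

(** The identity t_q g_j = e W t_q'. The units of O_d have order at most 6. *)
Definition decomp_ok (q j : nat) : bool :=
  let w := nth [::] (nth [::] decomp q) j in
  all (fun ij => (ij.1 < size refls) && (ij.2 < size refls))%N w &&
  has (fun k => meqb (mmul (nth mone reps q) (nth mone gs j))
     (smat (opow eps k) (mmul (even_prod w) (nth mone reps (act q j)))))
    (iota 0 6).

Definition coset_data_ok (t : table) : bool :=
  [&& table_ok t, agrees t (mred mone) 0,
      all unitaryb reps, meqb (nth mone reps 0) mone,
      all (fun q => agrees t (mred (nth mone reps q)) q) (iota 0 (size reps)),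
      all unitaryb refls, all (fun B => meqb (mmul B (mconj B)) mone) refls,
      all (fun B => all (fun C => agrees t (mred (mmul B (mconj C))) 0) refls) refls &
      all (fun q => all (decomp_ok q) (iota 0 (size gs))) (iota 0 (size reps))].

Variable t : table.
Hypothesis data_ok : coset_data_ok t.
Hypothesis gs_unitary : forall A, unitary A <-> word gs A.

Definition coset_nb A : nat := if lookup t (mred A) is Some (_, q) then q else 0%N.

Lemma agreesP A q : agrees t (mred A) q -> lookup t (mred A) = Some (mred A, q).
Proof.
by rewrite /agrees; case: lookup => [[A' q']|] // /andP[/meqbP -> /eqP ->].
Qed.

Lemma agrees_coset_nb A q : agrees t (mred A) q -> coset_nb A = q.
Proof. by rewrite /coset_nb => /agreesP ->. Qed.

Definition recorded A := lookup t (mred A) = Some (mred A, coset_nb A).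

(** The residue of A g_j depends on that of A alone. *)
Lemma recorded_step A j : recorded A -> (j < size gs)%N ->
  [/\ (coset_nb A < size reps)%N, act (coset_nb A) 5 = coset_nb A,
      recorded (mmul A (nth mone gs j)) &
      coset_nb (mmul A (nth mone gs j)) = act (coset_nb A) j].
Proof.
move=> rA hj; have /andP[tok _] := data_ok.
have hin := PositiveMap.elements_correct t (key (mred A)) rA.
have hpos : exists2 i, (i < size (PositiveMap.elements t))%N &
    nth (xH, (mone, 0%N)) (PositiveMap.elements t) i = (key (mred A), (mred A, coset_nb A)).
  elim: (PositiveMap.elements t) hin => [|e l IH] //= [->|/IH[i hi <-]].
    by exists 0%N.
  by exists i.+1.
have [i hi ei] := hpos.
have := all_nthP (xH, (mone, 0%N)) tok _ hi; rewrite ei /= => /and3P[h1 /eqP h2 h3].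
have hz : (j < size (zip gs (iota 0 (size gs))))%N.
  by rewrite size_zip size_iota minnn.
have := all_nthP (mone, 0%N) h3 _ hz.
rewrite nth_zip ?size_iota //= nth_iota // add0n mredM => hA.
split=> //; first by rewrite /recorded (agrees_coset_nb hA); apply: agreesP.
exact: agrees_coset_nb.
Qed.

Lemma recorded_unitary A : unitary A -> recorded A.
Proof.
move=> /gs_unitary; elim=> [|{}A j _ IH hj].
  have /and3P[_ h _] := data_ok.
  by rewrite /recorded (agrees_coset_nb h); apply: agreesP.
by have [] := recorded_step IH hj.
Qed.

Hypothesis gs_gt5 : (5 < size gs)%N.

Lemma coset_nb_lt A : unitary A -> (coset_nb A < size reps)%N.
Proof. by move=> /recorded_unitary rA; have [] := recorded_step rA gs_gt5. Qed.

Lemma coset_nb1 : coset_nb mone = 0%N.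
Proof. by have /and3P[_ h _] := data_ok; apply: agrees_coset_nb. Qed.

(** Writing C as a word in the generators, right multiplication by C acts on coset numbers. *)
Lemma coset_nb_congr A B C : unitary A -> unitary B -> unitary C ->
  coset_nb A = coset_nb B -> coset_nb (mmul A C) = coset_nb (mmul B C).
Proof.
move=> uA uB uC eAB; have := uC => /gs_unitary; elim=> [|{uC}C j wC IH hj].
  by rewrite !mmulm1.
have uC : unitary C by apply/gs_unitary.
rewrite !mmulA.
have [_ _ _ ->] := recorded_step (recorded_unitary (unitaryM uA uC)) hj.
have [_ _ _ ->] := recorded_step (recorded_unitary (unitaryM uB uC)) hj.
by rewrite IH.
Qed.

Hypothesis gs5 : nth mone gs 5 = smat eps mone.
Hypothesis units_eps : forall x, onorm x = 1 -> exists k, x = opow eps k.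

Lemma coset_nb_scale u A : onorm u = 1 -> unitary A -> coset_nb (smat u A) = coset_nb A.
Proof.
move=> /units_eps [k ->] uA.
have ueps : unitary (smat eps mone).
  by rewrite -gs5; apply/gs_unitary/word_gen.
suff [_ //] : unitary (smat (opow eps k) A) /\ coset_nb (smat (opow eps k) A) = coset_nb A.
elim: k => [|k [uk IH]]; first by rewrite smat1.
have -> : smat (opow eps k.+1) A = mmul (smat (opow eps k) A) (smat eps mone).
  by rewrite smatr mmulm1 smatA.
split; first exact: unitaryM.
by rewrite -gs5; have [_ e _ ->] := recorded_step (recorded_unitary uk) gs_gt5; rewrite e.
Qed.

Lemma rep_unitary q : (q < size reps)%N -> unitary (nth mone reps q).
Proof.
have /and4P[_ _ h _] := data_ok.
by move=> hq; apply: unitarybP; apply: (all_nthP mone h).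
Qed.

Lemma rep0 : nth mone reps 0 = mone.
Proof. by have /and5P[_ _ _ /meqbP h _] := data_ok. Qed.

Lemma coset_nb_rep q : (q < size reps)%N -> coset_nb (nth mone reps q) = q.
Proof.
have /and5P[_ _ _ _ /andP[h _]] := data_ok => hq.
apply: agrees_coset_nb; have := all_nthP 0%N h q; rewrite size_iota nth_iota // add0n.
exact.
Qed.

Lemma refl_ok i : (i < size refls)%N ->
  unitary (nth mone refls i) /\
  mmul (nth mone refls i) (mconj (nth mone refls i)) = mone.
Proof.
have /and5P[_ _ _ _ /and4P[_ h1 h2 _]] := data_ok => hi; split.
  by apply: unitarybP; apply: (all_nthP mone h1).
by apply: meqbP; apply: (all_nthP mone h2).
Qed.

Lemma coset_nb_refl2 i j : (i < size refls)%N -> (j < size refls)%N ->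
  coset_nb (mmul (nth mone refls i) (mconj (nth mone refls j))) = 0%N.
Proof.
have /and5P[_ _ _ _ /and5P[_ _ _ h _]] := data_ok => hi hj.
by apply: agrees_coset_nb; apply: (all_nthP mone (all_nthP mone h _ hi)).
Qed.

(** The reflections with matrices B and B' compose to the holomorphic map with matrix B B'^-. *)
Inductive even_word : mat -> Prop :=
| even_one : even_word mone
| even_step A i j : (i < size refls)%N -> (j < size refls)%N -> even_word A ->
    even_word (mmul (mmul (nth mone refls i) (mconj (nth mone refls j))) A).

Lemma even_wordM A B : even_word A -> even_word B -> even_word (mmul A B).
Proof.
move=> eA eB; elim: eA => [|C i j hi hj _ IH]; first by rewrite mmul1.
by rewrite -mmulA; apply: even_step.
Qed.

Lemma even_word_kernel A : even_word A -> unitary A /\ coset_nb A = 0%N.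
Proof.
elim=> [|{}A i j hi hj _ [uA cA]].
  by split; [exact: unitary1|exact: coset_nb1].
have [ui _] := refl_ok hi; have [uj _] := refl_ok hj.
have uij := unitaryM ui (unitary_conj uj).
split; first exact: unitaryM.
rewrite (coset_nb_congr uij unitary1 uA); first by rewrite mmul1.
by rewrite coset_nb_refl2 // coset_nb1.
Qed.

Lemma even_prodP w : all (fun ij => (ij.1 < size refls) && (ij.2 < size refls))%N w ->
  even_word (even_prod w).
Proof.
elim: w => [|[i j] w IH] /=; first by move=> _; apply: even_one.
by case/andP=> /andP[hi hj] /IH; apply: even_step.
Qed.

(** Schreier: by induction on a word in the generators, A is a unit times an even word times the
representative of its coset. *)
Theorem kernel_even A : unitary A -> coset_nb A = 0%N ->
  exists u E, even_word E /\ A = smat u E.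
Proof.
move=> uA cA.
suff [k [E [eE ->]]] : exists k E, even_word E /\
    A = smat (opow eps k) (mmul E (nth mone reps (coset_nb A))).
  by exists (opow eps k), E; rewrite cA rep0 mmulm1.
move/gs_unitary: uA; elim=> {cA A}[|A j wA [k [E [eE eA]]] hj].
  by exists 0%N, mone; rewrite coset_nb1 rep0 mmul1 smat1; split=> //; apply: even_one.
have uA : unitary A by apply/gs_unitary.
have [hq _ _ ->] := recorded_step (recorded_unitary uA) hj.
have /and5P[_ _ _ _ /and5P[_ _ _ _ hd]] := data_ok.
have hq' : (coset_nb A < size (iota 0 (size reps)))%N by rewrite size_iota.
have := all_nthP 0%N hd _ hq'; rewrite nth_iota // add0n => hd'.
have hj' : (j < size (iota 0 (size gs)))%N by rewrite size_iota.
have := all_nthP 0%N hd' _ hj'; rewrite nth_iota // add0n /decomp_ok.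
set w := nth _ _ _ => /andP[/even_prodP ew /hasP [l _ /meqbP el]].
exists (k + l)%N, (mmul E (even_prod w)); split; first exact: even_wordM.
rewrite {1}eA smatl -mmulA el smatr smatA mmulA; congr smat.
exact: opowD.
Qed.

End Cosets.
End Reduction.

(** The units lie in a small box, since 4 |x|^2 = tr(x)^2 + (4 N - T^2) x.2^2 with 4 N - T^2 at
least 3. *)
Definition units_ok (eps : oint) : bool :=
  all (fun a => all (fun b => (onorm (a, b) =? 1) ==>
                       has (fun k => oeqb (opow eps k) (a, b)) (iota 0 6))
                [:: -1; 0; 1]) [:: -2; -1; 0; 1; 2].

Lemma units_okP eps : units_ok eps -> forall x, onorm x = 1 -> exists k, x = opow eps k.
Proof.
move=> h [a b] hx.
have e : 4 * onorm (a, b) = (2 * a + T * b) * (2 * a + T * b) + (4 * N - T * T) * (b * b).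
  by rewrite /onorm; cbn [fst snd]; ring.
rewrite hx in e.
have hd : 3 <= 4 * N - T * T by case: TN discr_gt0 => [->|[-> [] ->]]; lia.
have b2 : b * b <= 1.
  by have := Z.square_nonneg (2 * a + T * b); have := Z.square_nonneg b; nia.
have hb : b = -1 \/ b = 0 \/ b = 1 by nia.
have a2 : (2 * a + T * b) * (2 * a + T * b) <= 4 by nia.
have a3 : -2 <= 2 * a + T * b <= 2 by nia.
have ha : a = -2 \/ a = -1 \/ a = 0 \/ a = 1 \/ a = 2.
  by case: TN a3 => [->|[-> _]]; lia.
have inst a' b' (ia ib : nat) : (ia < 5)%N -> (ib < 3)%N ->
    nth 0 [:: -2; -1; 0; 1; 2] ia = a' -> nth 0 [:: -1; 0; 1] ib = b' ->
    onorm (a', b') = 1 -> exists k, (a', b') = opow eps k.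
  move=> hia hib <- <- h1.
  have := all_nthP 0 (all_nthP 0 h ia hia) ib hib; rewrite h1 Z.eqb_refl implyTb.
  by case/hasP => k _ /oeqbP <-; exists k.
case: ha => [|[|[|[|]]]] ea; case: hb => [|[|]] eb; subst;
  first [exact: (inst _ _ 0 0)%N | exact: (inst _ _ 0 1)%N | exact: (inst _ _ 0 2)%N
        |exact: (inst _ _ 1 0)%N | exact: (inst _ _ 1 1)%N | exact: (inst _ _ 1 2)%N
        |exact: (inst _ _ 2 0)%N | exact: (inst _ _ 2 1)%N | exact: (inst _ _ 2 2)%N
        |exact: (inst _ _ 3 0)%N | exact: (inst _ _ 3 1)%N | exact: (inst _ _ 3 2)%N
        |exact: (inst _ _ 4 0)%N | exact: (inst _ _ 4 1)%N | exact: (inst _ _ 4 2)%N].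
Qed.

End Order.

(** * Certificates for d = 1, 2, 3, 7, 11 *)
Section Certificates.
Local Open Scope Z_scope.

(** A unit generating all the units; base matrices that complete the stabilizer of the cusp to a
generating set; the covering of the box, in the format of [cov_mat]; the basis (a, 0), (b, c) of an
ideal, as (a, b, c); coset representatives; the action of the generators on the cosets; matrices
of real reflections; and, for each coset and each generator, a word of pairs of indices of
reflections. *)
Record certificate := Certificate {
  cert_unit : oint;
  cert_bases : seq mat;
  cert_cover : seq (oint * oint * nat * nat);
  cert_ideal : Z * Z * Z;
  cert_reps : seq mat;
  cert_action : seq (seq nat);
  cert_reflections : seq mat;
  cert_words : seq (seq (seq (nat * nat))) }.

Definition cert_gens T N (c : certificate) : seq mat := gens T N (cert_unit c) (cert_bases c).

Definition cert_table T N (c : certificate) : table :=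
  let: (i, j, k) := cert_ideal c in
  coset_table T N i j k (cert_gens T N c) (cert_action c) (2 ^ 13).

(** 2^13 bounds the number of residues (6144 for d = 1, the largest case). *)
Definition cert_valid T N (c : certificate) : bool :=
  let: (i, j, k) := cert_ideal c in
  [&& units_ok T N (cert_unit c), all (unitaryb T N) (cert_gens T N c),
      all (cov_ok T N (cert_bases c)) (cert_cover c),
      covers T N 30 [seq cov_mat T N (cert_unit c) (cert_bases c) e | e <- cert_cover c] (cusp_box T),
      ideal_ok T N i j k, (0 < size (cert_reflections c))%N &
      coset_data_ok T N i j k (cert_gens T N c) (cert_reps c) (cert_reflections c) (cert_action c)
        (cert_unit c) (cert_words c) (cert_table T N c)].

(** The base matrix of index 0 exchanges the points at infinity (1, 0, 0) and (0, 0, 1). For d = 1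
and d = 3 its ball, centred at the origin, covers the whole box. The ideal is generated by
2 + 2i. *)
Definition certificate_1 : certificate := {|
  cert_unit := (0, 1);
  cert_bases :=
    [:: Mat (0, 0) (0, 0) (1, 0) (0, 0) (-1, 0) (0, 0) (1, 0) (0, 0) (0, 0)];
  cert_cover :=
    [:: ((0, 0), (0, 0), 0%N, 0%N)];
  cert_ideal := (4, 2, 2);
  cert_reps :=
    [:: Mat (1, 0) (0, 0) (0, 0) (0, 0) (1, 0) (0, 0) (0, 0) (0, 0) (1, 0);
        Mat (0, 0) (0, 0) (1, 0) (0, 0) (-1, 0) (0, 0) (1, 0) (0, 0) (0, 0);
        Mat (1, 0) (-1, 1) (-1, 0) (0, 0) (1, 0) (1, 1) (0, 0) (0, 0) (1, 0);
        Mat (1, 0) (0, 0) (0, 1) (0, 0) (1, 0) (0, 0) (0, 0) (0, 0) (1, 0);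
        Mat (1, 0) (-2, 0) (-2, 0) (0, 0) (1, 0) (2, 0) (0, 0) (0, 0) (1, 0);
        Mat (1, 0) (0, 0) (0, 0) (0, 0) (0, 1) (0, 0) (0, 0) (0, 0) (1, 0);
        Mat (0, 0) (0, 0) (1, 0) (0, 0) (-1, 0) (0, 0) (1, 0) (0, 0) (0, 1);
        Mat (0, 0) (0, 0) (1, 0) (0, 0) (0, -1) (0, 0) (1, 0) (0, 0) (0, 0)];
  cert_action :=
    [:: [:: 4; 2; 3; 7; 5; 0; 1]; [:: 2; 4; 6; 5; 7; 1; 0]; [:: 1; 0; 5; 6; 3; 2; 4];
        [:: 7; 5; 4; 0; 1; 3; 6]; [:: 0; 1; 7; 3; 6; 4; 2]; [:: 6; 3; 1; 2; 4; 5; 7];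
        [:: 5; 7; 2; 1; 0; 6; 3]; [:: 3; 6; 0; 4; 2; 7; 5]]%N;
  cert_reflections :=
    [:: Mat (0, 0) (0, 0) (-1, 0) (0, 0) (0, -1) (0, 0) (-1, 0) (0, 0) (0, 0);
        Mat (-1, 0) (0, 0) (0, 0) (0, 0) (-1, 0) (0, 0) (0, -1) (0, 0) (-1, 0);
        Mat (-1, 0) (0, 0) (0, 1) (0, 0) (1, 0) (0, 0) (0, 0) (0, 0) (-1, 0);
        Mat (-1, 0) (0, 0) (0, -1) (0, 0) (-1, 0) (0, 0) (0, 0) (0, 0) (-1, 0);
        Mat (-1, 0) (1, -1) (1, 0) (0, 0) (0, -1) (1, -1) (0, 0) (0, 0) (-1, 0);
        Mat (-1, 0) (-1, 1) (1, 0) (0, 0) (0, -1) (-1, 1) (0, 0) (0, 0) (-1, 0);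
        Mat (-1, 0) (0, 0) (0, 0) (0, 0) (1, 0) (0, 0) (0, 1) (0, 0) (-1, 0);
        Mat (-1, 0) (0, 0) (0, 0) (1, -1) (0, -1) (0, 0) (1, 0) (1, -1) (-1, 0);
        Mat (-1, 0) (0, 0) (0, 0) (-2, 0) (1, 0) (0, 0) (2, -1) (-2, 0) (-1, 0);
        Mat (-1, 0) (-1, -1) (1, 2) (0, 0) (0, 1) (-1, -1) (0, 0) (0, 0) (-1, 0);
        Mat (-1, 0) (1, 1) (1, 2) (0, 0) (0, 1) (1, 1) (0, 0) (0, 0) (-1, 0);
        Mat (-1, 0) (0, 0) (0, 0) (-1, -1) (0, 1) (0, 0) (1, -2) (-1, -1) (-1, 0);
        Mat (-1, 0) (-2, 0) (2, -1) (0, 0) (1, 0) (-2, 0) (0, 0) (0, 0) (-1, 0);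
        Mat (-1, 0) (0, 0) (0, 0) (0, -2) (-1, 0) (0, 0) (2, 1) (0, -2) (-1, 0);
        Mat (-1, 0) (2, 0) (2, -1) (0, 0) (1, 0) (2, 0) (0, 0) (0, 0) (-1, 0);
        Mat (-1, 0) (0, 0) (0, 0) (-1, 1) (0, -1) (0, 0) (1, 0) (-1, 1) (-1, 0);
        Mat (-1, 0) (0, 0) (0, 0) (1, 1) (0, 1) (0, 0) (1, -2) (1, 1) (-1, 0);
        Mat (-1, 0) (0, 2) (2, 1) (0, 0) (-1, 0) (0, 2) (0, 0) (0, 0) (-1, 0)];
  cert_words :=
    [:: [:: [::]; [::]; [::]; [:: (0, 1)]; [::]; [::]; [::]];
        [:: [:: (0, 2); (3, 4)]; [:: (0, 3); (2, 5)]; [::]; [:: (0, 3)]; [::]; [::]; [::]];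
        [:: [:: (0, 6); (7, 8)]; [:: (9, 10)]; [:: (3, 5)]; [:: (0, 11)]; [:: (2, 4)]; [::];
            [:: (2, 4); (6, 12)]];
        [:: [:: (0, 13)]; [:: (3, 5)]; [:: (14, 2)]; [::]; [:: (0, 6)]; [::]; [:: (3, 1)]];
        [:: [:: (12, 14)]; [:: (0, 13); (15, 1)]; [:: (0, 13)]; [:: (2, 14)];
            [:: (0, 6); (13, 1)]; [::]; [:: (6, 4); (16, 2)]];
        [:: [:: (0, 8)]; [:: (4, 3)]; [:: (0, 6)]; [:: (5, 3)]; [:: (3, 12)]; [::]; [::]];
        [:: [:: (0, 17)]; [:: (1, 7)]; [:: (0, 9)]; [::]; [:: (0, 2)]; [::]; [:: (1, 3)]];
        [:: [:: (0, 14)]; [:: (15, 1)]; [:: (0, 2)]; [:: (0, 12)]; [:: (0, 2); (5, 3)]; [::];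
            [::]]]%N
|}.

Lemma certificate_1_valid : cert_valid 0 1 certificate_1.
Proof. by vm_compute. Qed.

Definition certificate_2 : certificate := {|
  cert_unit := (-1, 0);
  cert_bases :=
    [:: Mat (0, 0) (0, 0) (1, 0) (0, 0) (-1, 0) (0, 0) (1, 0) (0, 0) (0, 0);
        Mat (1, 0) (0, 0) (0, 0) (0, -1) (1, 0) (0, 0) (-1, 1) (0, -1) (1, 0);
        Mat (1, 0) (0, 0) (0, 0) (0, 1) (1, 0) (0, 0) (-1, -1) (0, 1) (1, 0)];
  cert_cover :=
    [:: ((0, 0), (0, 0), 0%N, 0%N); ((0, -1), (-1, -1), 0%N, 1%N); ((0, 0), (0, 0), 0%N, 2%N);
        ((0, 0), (0, 0), 0%N, 1%N); ((0, 1), (-1, 1), 0%N, 2%N); ((0, 0), (0, 0), 1%N, 1%N);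
        ((0, -1), (-1, 1), 1%N, 2%N); ((0, 1), (-1, -1), 1%N, 1%N); ((0, 0), (0, 0), 1%N, 2%N)];
  cert_ideal := (2, 0, 2);
  cert_reps :=
    [:: Mat (1, 0) (0, 0) (0, 0) (0, 0) (1, 0) (0, 0) (0, 0) (0, 0) (1, 0);
        Mat (0, 0) (0, 0) (1, 0) (0, 0) (-1, 0) (0, 0) (1, 0) (0, 0) (0, 0);
        Mat (1, 0) (0, 0) (0, 1) (0, 0) (1, 0) (0, 0) (0, 0) (0, 0) (1, 0);
        Mat (0, 0) (0, 0) (1, 0) (0, 0) (-1, 0) (0, 0) (1, 0) (0, 0) (0, 1)];
  cert_action :=
    [:: [:: 0; 1; 2; 2; 0; 0; 1; 3; 3]; [:: 1; 0; 3; 3; 1; 1; 0; 2; 2];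
        [:: 2; 3; 0; 0; 2; 2; 3; 1; 1]; [:: 3; 2; 1; 1; 3; 3; 2; 0; 0]]%N;
  cert_reflections :=
    [:: Mat (-1, 0) (0, 1) (1, -2) (0, 0) (-1, 0) (0, 1) (0, 0) (0, 0) (-1, 0);
        Mat (-1, 1) (0, 1) (1, 0) (-2, 0) (-1, 0) (0, 1) (-2, -2) (-2, 0) (-1, 1);
        Mat (-3, 2) (2, 1) (1, 0) (-8, 0) (1, 4) (2, 1) (0, -8) (-8, 0) (-3, 2);
        Mat (-1, -1) (0, 1) (1, 0) (2, -2) (-3, 0) (0, 1) (2, 2) (2, -2) (-1, -1);
        Mat (0, 0) (0, 0) (-1, 0) (0, 0) (1, 0) (0, 0) (-1, 0) (0, 0) (0, 0);
        Mat (-1, 0) (0, 0) (0, 0) (0, -1) (-1, 0) (0, 0) (1, 0) (0, -1) (-1, 0);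
        Mat (-1, 0) (0, 1) (1, 0) (0, 0) (-1, 0) (0, 1) (0, 0) (0, 0) (-1, 0);
        Mat (0, 0) (0, 0) (-1, 0) (0, 0) (-1, 0) (0, 0) (-1, 0) (0, 0) (0, 0);
        Mat (-1, 0) (0, 0) (0, 0) (0, 1) (-1, 0) (0, 0) (1, -2) (0, 1) (-1, 0);
        Mat (0, -1) (0, 0) (-1, 0) (0, 0) (1, 0) (0, 0) (1, 0) (0, 0) (0, -1);
        Mat (-1, 0) (0, 0) (0, 0) (0, -1) (-1, 0) (0, 0) (1, -2) (0, -1) (-1, 0);
        Mat (-1, 1) (2, 0) (-2, -2) (0, -1) (-1, 0) (2, 0) (1, 0) (0, -1) (-1, 1);
        Mat (-3, 2) (8, 0) (0, -8) (-2, -1) (1, 4) (8, 0) (1, 0) (-2, -1) (-3, 2);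
        Mat (-1, -1) (-2, 2) (2, 2) (0, -1) (-3, 0) (-2, 2) (1, 0) (0, -1) (-1, -1);
        Mat (-1, 0) (0, 0) (0, 0) (0, 1) (-1, 0) (0, 0) (1, 0) (0, 1) (-1, 0);
        Mat (-1, 0) (0, -1) (1, -2) (0, 0) (-1, 0) (0, -1) (0, 0) (0, 0) (-1, 0);
        Mat (0, -1) (0, 0) (1, 0) (0, 0) (1, 0) (0, 0) (-1, 0) (0, 0) (0, -1);
        Mat (-1, 0) (0, 1) (1, 2) (0, 0) (-1, 0) (0, 1) (0, 0) (0, 0) (-1, 0);
        Mat (0, -1) (0, 0) (1, 0) (0, 0) (-1, 0) (0, 0) (-1, 0) (0, 0) (0, -1);
        Mat (-1, 0) (0, 0) (0, 0) (0, 1) (-1, 0) (0, 0) (1, 2) (0, 1) (-1, 0);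
        Mat (0, -1) (0, 0) (-1, 0) (0, 0) (-1, 0) (0, 0) (1, 0) (0, 0) (0, -1)];
  cert_words :=
    [:: [:: [:: (0, 1); (2, 3)]; [:: (4, 5)]; [::]; [:: (6, 0)]; [:: (4, 7)]; [::]; [::];
            [:: (8, 9)]; [:: (5, 9)]];
        [:: [:: (10, 11); (12, 13)]; [:: (4, 6)]; [::]; [:: (14, 8)]; [:: (4, 7)]; [::]; [::];
            [:: (15, 16)]; [:: (6, 16)]];
        [:: [:: (0, 1); (2, 3)]; [:: (4, 5)]; [:: (6, 17)]; [::]; [:: (4, 7)]; [::];
            [:: (4, 18); (14, 8)]; [:: (16, 6)]; [:: (16, 15)]];
        [:: [:: (10, 11); (12, 13)]; [:: (4, 6)]; [:: (14, 19)]; [::]; [:: (4, 7)]; [::];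
            [:: (4, 20); (6, 0)]; [:: (9, 5)]; [:: (9, 8)]]]%N
|}.

Lemma certificate_2_valid : cert_valid 0 2 certificate_2.
Proof. by vm_compute. Qed.

(** The ideal is generated by sqrt(-3). *)
Definition certificate_3 : certificate := {|
  cert_unit := (0, 1);
  cert_bases :=
    [:: Mat (0, 0) (0, 0) (1, 0) (0, 0) (-1, 0) (0, 0) (1, 0) (0, 0) (0, 0)];
  cert_cover :=
    [:: ((0, 0), (0, 0), 0%N, 0%N)];
  cert_ideal := (3, -2, 1);
  cert_reps :=
    [:: Mat (1, 0) (0, 0) (0, 0) (0, 0) (1, 0) (0, 0) (0, 0) (0, 0) (1, 0);
        Mat (1, 0) (0, 0) (0, 0) (0, 0) (-1, 0) (0, 0) (0, 0) (0, 0) (1, 0)];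
  cert_action :=
    [:: [:: 0; 0; 0; 0; 1; 0; 0]; [:: 1; 1; 1; 1; 0; 1; 1]]%N;
  cert_reflections :=
    [:: Mat (-1, 0) (0, 0) (0, 0) (0, 0) (1, 0) (0, 0) (0, 0) (0, 0) (-1, 0);
        Mat (-1, 0) (1, 0) (0, 1) (0, 0) (1, 0) (1, 0) (0, 0) (0, 0) (-1, 0);
        Mat (-1, 0) (0, 0) (0, 0) (0, 0) (-1, 1) (0, 0) (0, 0) (0, 0) (-1, 0);
        Mat (-1, 0) (0, 1) (0, 1) (0, 0) (-1, 1) (0, 1) (0, 0) (0, 0) (-1, 0);
        Mat (-1, 0) (0, 0) (-1, 2) (0, 0) (1, 0) (0, 0) (0, 0) (0, 0) (-1, 0);
        Mat (-1, 0) (0, 0) (1, -2) (0, 0) (1, 0) (0, 0) (0, 0) (0, 0) (-1, 0);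
        Mat (-1, 0) (0, 0) (0, 0) (0, 0) (0, -1) (0, 0) (0, 0) (0, 0) (-1, 0);
        Mat (0, 0) (0, 0) (-1, 0) (0, 0) (-1, 0) (0, 0) (-1, 0) (0, 0) (0, 0);
        Mat (-1, 0) (-1, 0) (0, 1) (0, 0) (1, 0) (-1, 0) (0, 0) (0, 0) (-1, 0);
        Mat (-1, 0) (0, -1) (0, 1) (0, 0) (-1, 1) (0, -1) (0, 0) (0, 0) (-1, 0)];
  cert_words :=
    [:: [:: [:: (0, 1)]; [:: (2, 3)]; [:: (0, 4)]; [:: (0, 5)]; [:: (6, 0)]; [::]; [:: (0, 7)]];
        [:: [:: (0, 8)]; [:: (2, 9)]; [:: (0, 4)]; [:: (0, 5)]; [:: (6, 0)]; [::]; [:: (0, 7)]]]%N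
|}.

Lemma certificate_3_valid : cert_valid 1 1 certificate_3.
Proof. by vm_compute. Qed.

(** The ideal is generated by sqrt(-7). *)
Definition certificate_7 : certificate := {|
  cert_unit := (-1, 0);
  cert_bases :=
    [:: Mat (0, 0) (0, 0) (1, 0) (0, 0) (-1, 0) (0, 0) (1, 0) (0, 0) (0, 0);
        Mat (1, 0) (0, -1) (-1, 0) (1, 0) (1, -1) (0, -1) (-1, 1) (1, 0) (1, 0);
        Mat (2, -1) (-1, 0) (-1, -1) (1, -1) (-1, 1) (-1, 0) (0, 1) (1, -1) (2, -1)];
  cert_cover :=
    [:: ((1, 0), (0, -1), 0%N, 0%N); ((0, 1), (-1, 0), 0%N, 1%N); ((1, 0), (-1, 1), 0%N, 2%N);
        ((0, 1), (-2, 2), 0%N, 2%N); ((0, 0), (0, 0), 0%N, 1%N); ((0, 0), (0, 0), 0%N, 0%N);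
        ((0, 0), (0, 0), 0%N, 2%N); ((-1, 0), (-1, 1), 0%N, 0%N); ((1, 0), (-1, 1), 0%N, 0%N)];
  cert_ideal := (7, -4, 1);
  cert_reps :=
    [:: Mat (1, 0) (0, 0) (0, 0) (0, 0) (1, 0) (0, 0) (0, 0) (0, 0) (1, 0);
        Mat (1, 0) (0, 0) (0, 0) (0, 0) (-1, 0) (0, 0) (0, 0) (0, 0) (1, 0)];
  cert_action :=
    [:: [:: 0; 0; 0; 0; 1; 0; 1; 0; 1]; [:: 1; 1; 1; 1; 0; 1; 0; 1; 0]]%N;
  cert_reflections :=
    [:: Mat (-1, 0) (0, 0) (0, 0) (0, 0) (1, 0) (0, 0) (0, 0) (0, 0) (-1, 0);
        Mat (-1, 0) (1, 0) (0, 1) (0, 0) (1, 0) (1, 0) (0, 0) (0, 0) (-1, 0);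
        Mat (-1, 0) (1, 0) (1, -1) (0, 0) (1, 0) (1, 0) (0, 0) (0, 0) (-1, 0);
        Mat (0, -1) (1, 2) (-1, 3) (-1, -1) (3, 1) (1, 2) (0, 1) (-1, -1) (0, -1);
        Mat (-1, 0) (0, 0) (0, 0) (-1, 0) (1, 0) (0, 0) (0, 1) (-1, 0) (-1, 0);
        Mat (-1, 1) (0, 1) (-1, -1) (1, 0) (0, 0) (0, 1) (1, 0) (1, 0) (-1, 1);
        Mat (-1, 0) (0, 0) (-1, 2) (0, 0) (1, 0) (0, 0) (0, 0) (0, 0) (-1, 0);
        Mat (-1, 0) (0, 0) (1, -2) (0, 0) (1, 0) (0, 0) (0, 0) (0, 0) (-1, 0);
        Mat (0, 0) (0, 0) (-1, 0) (0, 0) (1, 0) (0, 0) (-1, 0) (0, 0) (0, 0);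
        Mat (-1, 0) (-1, 0) (0, 1) (0, 0) (1, 0) (-1, 0) (0, 0) (0, 0) (-1, 0);
        Mat (-1, 0) (0, 0) (0, 0) (1, 0) (1, 0) (0, 0) (0, 1) (1, 0) (-1, 0);
        Mat (-1, -1) (-1, 0) (2, -1) (0, 1) (0, 1) (-1, 0) (-1, 1) (0, 1) (-1, -1);
        Mat (-1, 0) (-1, 0) (1, -1) (0, 0) (1, 0) (-1, 0) (0, 0) (0, 0) (-1, 0);
        Mat (0, -1) (-1, -2) (-1, 3) (1, 1) (3, 1) (-1, -2) (0, 1) (1, 1) (0, -1);
        Mat (-1, 1) (0, -1) (-1, -1) (-1, 0) (0, 0) (0, -1) (1, 0) (-1, 0) (-1, 1);
        Mat (-1, -1) (1, 0) (2, -1) (0, -1) (0, 1) (1, 0) (-1, 1) (0, -1) (-1, -1)];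
  cert_words :=
    [:: [:: [:: (0, 1)]; [:: (2, 3); (4, 5)]; [:: (0, 6)]; [:: (0, 7)]; [::]; [::]; [:: (8, 0)];
            [:: (9, 10); (7, 5)]; [:: (0, 11)]];
        [:: [:: (0, 9)]; [:: (12, 13); (10, 14)]; [:: (0, 6)]; [:: (0, 7)]; [::]; [::];
            [:: (8, 0)]; [:: (1, 4); (7, 14)]; [:: (0, 15)]]]%N
|}.

Lemma certificate_7_valid : cert_valid 1 2 certificate_7.
Proof. by vm_compute. Qed.

Definition certificate_11 : certificate := {|
  cert_unit := (-1, 0);
  cert_bases :=
    [:: Mat (0, 0) (0, 0) (1, 0) (0, 0) (-1, 0) (0, 0) (1, 0) (0, 0) (0, 0)];
  cert_cover :=
    [:: ((0, 0), (0, 0), 0%N, 0%N); ((-1, 0), (0, -1), 0%N, 0%N); ((1, 0), (0, -1), 0%N, 0%N);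
        ((-1, 0), (-1, 1), 0%N, 0%N); ((1, 0), (-1, 1), 0%N, 0%N);
        ((0, -1), (-1, -1), 0%N, 0%N); ((0, 1), (-1, -1), 0%N, 0%N);
        ((1, -1), (-2, 1), 0%N, 0%N); ((-1, 1), (-2, 1), 0%N, 0%N);
        ((0, -1), (-2, 1), 0%N, 0%N); ((0, 1), (-2, 1), 0%N, 0%N);
        ((1, -1), (-1, -1), 0%N, 0%N); ((-1, 1), (-1, -1), 0%N, 0%N)];
  cert_ideal := (2, 0, 2);
  cert_reps :=
    [:: Mat (1, 0) (0, 0) (0, 0) (0, 0) (1, 0) (0, 0) (0, 0) (0, 0) (1, 0);
        Mat (1, 0) (-1, 1) (-2, 1) (0, 0) (1, 0) (0, 1) (0, 0) (0, 0) (1, 0)];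
  cert_action :=
    [:: [:: 0; 1; 0; 0; 0; 0; 0]; [:: 1; 0; 1; 1; 1; 1; 1]]%N;
  cert_reflections :=
    [:: Mat (-1, 0) (0, 0) (0, 0) (0, 0) (1, 0) (0, 0) (0, 0) (0, 0) (-1, 0);
        Mat (-1, 0) (1, 0) (0, 1) (0, 0) (1, 0) (1, 0) (0, 0) (0, 0) (-1, 0);
        Mat (-1, 0) (0, 0) (0, 0) (0, 0) (-1, 0) (0, 0) (0, 0) (0, 0) (-1, 0);
        Mat (-1, 0) (0, 0) (-1, 2) (0, 0) (-1, 0) (0, 0) (0, 0) (0, 0) (-1, 0);
        Mat (-1, 0) (0, 0) (1, -2) (0, 0) (-1, 0) (0, 0) (0, 0) (0, 0) (-1, 0);
        Mat (0, 0) (0, 0) (-1, 0) (0, 0) (1, 0) (0, 0) (-1, 0) (0, 0) (0, 0);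
        Mat (0, 0) (0, 0) (-1, 0) (0, 0) (-1, 0) (0, 0) (-1, 0) (0, 0) (0, 0);
        Mat (-1, 0) (1, 0) (-1, 3) (0, 0) (1, 0) (1, 0) (0, 0) (0, 0) (-1, 0);
        Mat (-1, 0) (-1, 2) (5, 1) (0, 0) (-1, 0) (-1, 2) (0, 0) (0, 0) (-1, 0);
        Mat (-1, 0) (-1, 0) (0, 1) (0, 0) (1, 0) (-1, 0) (0, 0) (0, 0) (-1, 0);
        Mat (-1, 0) (1, -2) (4, 3) (0, 0) (-1, 0) (1, -2) (0, 0) (0, 0) (-1, 0);
        Mat (-1, 0) (-1, 0) (2, -3) (0, 0) (1, 0) (-1, 0) (0, 0) (0, 0) (-1, 0);
        Mat (-2, 1) (-4, 0) (0, -4) (0, 1) (-2, 1) (-4, 0) (1, 0) (0, 1) (-2, 1)];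
  cert_words :=
    [:: [:: [:: (0, 1)]; [::]; [:: (2, 3)]; [:: (2, 4)]; [:: (5, 6)]; [::]; [:: (5, 2)]];
        [:: [:: (0, 7)]; [:: (5, 6); (8, 1)]; [:: (2, 3)]; [:: (2, 4)]; [:: (9, 10)]; [::];
            [:: (11, 12)]]]%N
|}.

Lemma certificate_11_valid : cert_valid 1 3 certificate_11.
Proof. by vm_compute. Qed.

End Certificates.

From mathcomp Require Import ring ssrZ zify.

Import Order.TTheory GRing.Theory Num.Theory.
Import numFieldNormedType.Exports.
Local Open Scope classical_set_scope.
Local Open Scope card_scope.
Local Open Scope ring_scope.
Delimit Scope Z_scope with coqZ.

(** * Holomorphic and antiholomorphic motions of the complex hyperbolic plane *)
Section ComplexPlane.
Variable R : realType.
Local Notation C := R[i].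
Local Notation V := 'cV[C]_3.
Local Notation H2C := (H2C R).

(** The boolean is true for antiholomorphic motions. *)
Definition twist (b : bool) : {rmorphism C -> C} :=
  if b then (Num.conj : {rmorphism C -> C}) else idfun.

Lemma twistK b : involutive (twist b).
Proof. by case: b => c //=; rewrite conjCK. Qed.

Lemma twistD b1 b2 c : twist b1 (twist b2 c) = twist (b1 (+) b2) c.
Proof. by case: b1; case: b2 => //=; rewrite conjCK. Qed.

Lemma twist_conj b (c : C) : twist b c^* = (twist b c)^*.
Proof. by case: b. Qed.

Lemma hermDl (u v w : V) : herm (u + v) w = herm u w + herm v w.
Proof. by rewrite /herm !mxE; ring. Qed.

Lemma hermZ (a b : C) (u v : V) : herm (a *: u) (b *: v) = a * b^* * herm u v.
Proof.
by rewrite /herm !mxE !rmorphM /=; ring.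
Qed.

Lemma herm_conj (u v : V) : (herm u v)^* = herm v u.
Proof.
by rewrite /herm !rmorphD !rmorphM /= !conjCK; ring.
Qed.

Lemma herm_twist b (u v : V) :
  herm (map_mx (twist b) u) (map_mx (twist b) v) = twist b (herm u v).
Proof. by rewrite /herm !mxE !rmorphD !rmorphM /= !twist_conj. Qed.

Lemma hermDr (u v w : V) : herm w (u + v) = herm w u + herm w v.
Proof. by rewrite -herm_conj hermDl rmorphD /= !herm_conj. Qed.

Lemma hermNl (u v : V) : herm (- u) v = - herm u v.
Proof. by rewrite /herm !mxE; ring. Qed.

Lemma hermNr (u v : V) : herm u (- v) = - herm u v.
Proof. by rewrite -herm_conj hermNl rmorphN /= herm_conj. Qed.

Lemma herm0l (v : V) : herm 0 v = 0.
Proof. by rewrite /herm !mxE !mul0r !addr0. Qed.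

Lemma herm_nondeg (u : V) : (forall v, herm u v = 0) -> u = 0.
Proof.
move=> h; apply/matrixP => i j; rewrite ord1 mxE {j}.
have := h (delta_mx (rev_ord i) 0); rewrite /herm !mxE.
by case: i => [[|[|[|]]] //= hi] <-; rewrite ?conjC0 ?conjC1 ?mulr0 ?mulr1 ?addr0 ?add0r;
  congr (u _ 0); apply: val_inj.
Qed.

Definition isom (b : bool) (A : 'M[C]_3) (v : V) : V := A *m map_mx (twist b) v.

Lemma isomD b A u v : isom b A (u + v) = isom b A u + isom b A v.
Proof. by rewrite /isom map_mxD mulmxDr. Qed.
Lemma isomZ b A c v : isom b A (c *: v) = twist b c *: isom b A v.
Proof. by rewrite /isom map_mxZ -scalemxAr. Qed.
Lemma isom0 b (A : 'M[C]_3) : isom b A 0 = 0.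
Proof. by rewrite -[0 in LHS](scale0r (0 : V)) isomZ rmorph0 scale0r. Qed.

Lemma isom_herm b A u v : U21 A -> herm (isom b A u) (isom b A v) = twist b (herm u v).
Proof. by move=> uA; rewrite /isom uA herm_twist. Qed.

Lemma isom_comp b1 b2 A B v :
  isom b1 A (isom b2 B v) = isom (b1 (+) b2) (A *m map_mx (twist b1) B) v.
Proof.
rewrite /isom map_mxM mulmxA -map_mx_comp; congr (_ *m _).
by apply/matrixP=> i j; rewrite !mxE /= twistD.
Qed.

Lemma isom_inj b (A : 'M[C]_3) : U21 A -> injective (isom b A).
Proof.
move=> uA u v e; apply/eqP; rewrite -subr_eq0; apply/eqP/herm_nondeg => w.
apply: (can_inj (@twistK b)); rewrite rmorph0 -(isom_herm b _ _ uA).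
by rewrite isomD -[- v]scaleN1r isomZ rmorphN rmorph1 scaleN1r e subrr herm0l.
Qed.

Lemma line_generator (p : H2C) (v : V) : v \in val p -> v != 0 -> val p = <[v]>%VS.
Proof.
move=> hv v0; apply/esym/eqP; rewrite eqEdim -memvE hv /= dim_vline v0.
by have /andP[/eqP -> _] := valP p.
Qed.

Lemma vpick_neq0 (p : H2C) : vpick (val p) != 0.
Proof. by rewrite vpick0 -dimv_eq0; have /andP[/eqP -> _] := valP p. Qed.

Lemma line_coef (p : H2C) (v : V) : v \in val p -> v != 0 ->
  exists2 c, c != 0 & v = c *: vpick (val p).
Proof.
rewrite {1}(line_generator (memv_pick _) (vpick_neq0 p)) => /vlineP [c ev] v0.
by exists c => //; apply: contra_neq v0 => c0; rewrite ev c0 scale0r.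
Qed.

Lemma vpick_herm (p : H2C) (v : V) : v \in val p -> v != 0 -> herm v v < 0.
Proof. by have /andP[_ /asboolP h] := valP p; apply: h. Qed.

Lemma negative_line_vline (v : V) : herm v v < 0 -> negative_line <[v]>%VS.
Proof.
move=> hv; have v0 : v != 0 by apply: contraTneq hv => ->; rewrite herm0l ltxx.
rewrite /negative_line dim_vline v0 eqxx; apply/asboolP => w /vlineP [c ->].
rewrite scaler_eq0 negb_or => /andP[c0 _]; rewrite hermZ.
by rewrite pmulr_rlt0 // -normCK exprn_gt0 // normr_gt0.
Qed.

Definition negative_point (v : V) (hv : herm v v < 0) : H2C :=
  exist _ <[v]>%VS (negative_line_vline hv).

(** For unitary A the line of [isom b A v] is negative, and the default value of [insubd] is not
taken. *)
Definition motion b A (p : H2C) : H2C := insubd p <[isom b A (vpick (val p))]>%VS.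

Lemma motion_val b A (p : H2C) (v : V) : U21 A -> v \in val p -> v != 0 ->
  val (motion b A p) = <[isom b A v]>%VS.
Proof.
move=> uA hv v0.
have [c c0 ev] := line_coef hv v0.
have -> : <[isom b A v]>%VS = <[isom b A (vpick (val p))]>%VS.
  rewrite ev isomZ; apply/eqP; rewrite eqEsubv; apply/andP; split; rewrite -memvE.
    by rewrite memvZ ?memv_line.
  apply/vlineP; exists (twist b c)^-1.
  by rewrite scalerA mulVf ?scale1r // fmorph_eq0.
rewrite /motion insubdK //; apply: negative_line_vline.
rewrite isom_herm //; have := vpick_herm (memv_pick (val p)) (vpick_neq0 p).
by case: b => //=; rewrite herm_conj.
Qed.

Lemma motion_mem b A (p : H2C) (v : V) : U21 A -> v \in val p -> isom b A v \in val (motion b A p).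
Proof.
move=> uA hv; have [->|v0] := eqVneq v 0; first by rewrite isom0 mem0v.
by rewrite (motion_val b uA hv v0) memv_line.
Qed.

Lemma H2C_eq (p q : H2C) v : v \in val p -> v \in val q -> v != 0 -> p = q.
Proof.
by move=> hp hq v0; apply: val_inj; rewrite (line_generator hp v0) (line_generator hq v0).
Qed.

Lemma isom_neq0 b A (v : V) : U21 A -> v != 0 -> isom b A v != 0.
Proof. by move=> uA; apply: contra_neq => h; apply: (isom_inj uA (b := b)); rewrite isom0. Qed.

Lemma map_twistK b m n : involutive (@map_mx _ _ (twist b) m n).
Proof. by move=> M; apply/matrixP=> i j; rewrite !mxE twistK. Qed.

Lemma U21_twist b (A : 'M[C]_3) : U21 A -> U21 (map_mx (twist b) A).
Proof.
move=> uA Z W; rewrite -[Z](map_twistK b) -[W](map_twistK b) -!map_mxM.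
by rewrite [LHS]herm_twist uA !herm_twist.
Qed.

Lemma U21_mul (A B : 'M[C]_3) : U21 A -> U21 B -> U21 (A *m B).
Proof. by move=> uA uB Z W; rewrite -!mulmxA uA uB. Qed.

Lemma motion_comp b1 b2 (A B : 'M[C]_3) : U21 A -> U21 B ->
  motion b1 A \o motion b2 B = motion (b1 (+) b2) (A *m map_mx (twist b1) B).
Proof.
move=> uA uB; have uAB := U21_mul uA (U21_twist b1 uB).
apply/funext => p /=; have v0 := vpick_neq0 p; have hv := memv_pick (val p).
apply: (H2C_eq (v := isom b1 A (isom b2 B (vpick (val p))))).
- by do 2 apply: motion_mem => //.
- by rewrite isom_comp; apply: motion_mem.
- by do 2 apply: isom_neq0 => //.
Qed.

Lemma motion1 : motion false 1%:M = id.
Proof.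
have u1 : U21 (1%:M : 'M[C]_3) by move=> Z W; rewrite !mul1mx.
apply/funext => p; apply: (H2C_eq (v := vpick (val p))).
- have -> : vpick (val p) = isom false 1%:M (vpick (val p)).
    by rewrite /isom mul1mx; apply/matrixP => i j; rewrite !mxE.
  by apply: motion_mem => //; rewrite memv_pick.
- exact: memv_pick.
- exact: vpick_neq0.
Qed.

Lemma isomFE A v : isom false A v = A *m v.
Proof. by rewrite /isom; congr (_ *m _); apply/matrixP => i j; rewrite !mxE. Qed.

Lemma inducesP (A : 'M[C]_3) f : U21 A -> induces A f <-> f = motion false A.
Proof.
move=> uA.
have key (p : H2C) : (linfun (mulmx A) @: val p)%VS = val (motion false A p).
  rewrite (motion_val _ uA (memv_pick _) (vpick_neq0 p)) isomFE.
  rewrite {1}(line_generator (memv_pick _) (vpick_neq0 p)) limg_line.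
  by rewrite lfunE.
split=> [h|-> p]; last by rewrite key.
by apply/funext => p; apply: val_inj; rewrite h key.
Qed.

(** The distance does not depend on the vectors that represent the two lines: rescaling u and v
multiplies numerator and denominator by the same factor. *)
Lemma dist_vec (p q : H2C) (u v : V) :
  u \in val p -> u != 0 -> v \in val q -> v != 0 ->
  dist p q = 2 * arcosh (Num.sqrt (complex.Re
     (herm u v * herm v u / (herm u u * herm v v)))).
Proof.
move=> hu u0 hv v0; rewrite /dist; congr (2 * arcosh (Num.sqrt (complex.Re _))).
have [c c0 ec] := line_coef hu u0; have [d d0 ed] := line_coef hv v0.
rewrite ec ed !hermZ.
have hp := lt_eqF (vpick_herm (memv_pick (val p)) (vpick_neq0 p)).
have hq := lt_eqF (vpick_herm (memv_pick (val q)) (vpick_neq0 q)).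
have cc0 : c^* != 0 by rewrite conjC_eq0.
have dd0 : d^* != 0 by rewrite conjC_eq0.
move: hp hq; set x := herm _ _; set y := herm _ _; set z := herm _ _; set w := herm _ _.
by move=> /negbT hp /negbT hq; field; rewrite ?c0 ?d0 ?cc0 ?dd0 ?hp ?hq.
Qed.

Lemma Re_conj (z : C) : complex.Re z^* = complex.Re z.
Proof. by case: z. Qed.

Lemma motion_isometric b (A : 'M[C]_3) : U21 A -> isometric (motion b A).
Proof.
move=> uA p q.
have hp := memv_pick (val p); have p0 := vpick_neq0 p.
have hq := memv_pick (val q); have q0 := vpick_neq0 q.
rewrite (dist_vec (motion_mem b uA hp) (isom_neq0 b uA p0)
                  (motion_mem b uA hq) (isom_neq0 b uA q0)).
rewrite (dist_vec hp p0 hq q0) !isom_herm // -!rmorphM -fmorph_div /=.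
by case: b => //=; rewrite Re_conj.
Qed.

Lemma coord2_neq0 (p : H2C) (v : V) : v \in val p -> v != 0 -> v 2 0 != 0.
Proof.
move=> hv v0; have := vpick_herm hv v0; apply: contraTneq => h.
rewrite /herm h conjC0 mulr0 mul0r add0r addr0 -normCK.
by rewrite le_gtF // exprn_ge0.
Qed.

Lemma chartE (p : H2C) (v : V) : v \in val p -> v != 0 ->
  chart p = (v 0 0 / v 2 0, v 1 0 / v 2 0).
Proof.
move=> hv v0; have [c c0 ev] := line_coef hv v0.
have h2 := coord2_neq0 (memv_pick (val p)) (vpick_neq0 p).
by rewrite /chart ev !mxE; congr (_, _); field; rewrite c0 h2.
Qed.

Definition affine_row (A : 'M[C]_3) (i : 'I_3) (z : C^o * C^o) : C^o :=
  A i 0 * z.1 + A i 1 * z.2 + A i 2.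

Lemma affine_rowE (A : 'M[C]_3) i (v : V) : v 2 0 != 0 ->
  affine_row A i (v 0 0 / v 2 0, v 1 0 / v 2 0) = (A *m v) i 0 / v 2 0.
Proof.
move=> v2; rewrite /affine_row mxE !big_ord_recl big_ord0 /=.
have -> : lift ord0 (ord0 : 'I_2) = 1 :> 'I_3 by apply: val_inj.
have -> : lift ord0 (lift ord0 (ord0 : 'I_1)) = 2 :> 'I_3 by apply: val_inj.
by field.
Qed.

Lemma differentiable_linear (f : C^o * C^o -> C^o) z :
  linear f -> continuous f -> differentiable f z.
Proof.
move=> f_lin f_cont.
pose f_linear := GRing.isLinear.Build _ _ _ _ _ f_lin.
pose g : {linear (C^o * C^o)%type -> C^o} := HB.pack f f_linear.
exact: (@linear_differentiable _ _ _ g).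
Qed.

Lemma differentiable_affine_row (A : 'M[C]_3) i z : differentiable (affine_row A i) z.
Proof.
apply: differentiableD; last exact: differentiable_cst.
apply: differentiableD; apply: differentiableM; try exact: differentiable_cst.
  by apply: differentiable_linear => [//|x]; exact: cvg_fst.
by apply: differentiable_linear => [//|x]; exact: cvg_snd.
Qed.

(** In the chart a motion is a quotient of affine functions, after conjugating its value in the
antiholomorphic case. *)
Lemma motion_differentiable b (A : 'M[C]_3) : U21 A ->
  exists F : C^o * C^o -> C^o * C^o,
    (forall p, F (chart p) = (twist b (chart (motion b A p)).1,
                              twist b (chart (motion b A p)).2)) /\
    (forall p, differentiable F (chart p)).
Proof.
move=> uA; pose B := map_mx (twist b) A.
exists (fun z => (affine_row B 0 z / affine_row B 2 z,
                  affine_row B 1 z / affine_row B 2 z)).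
have den (p : H2C) : affine_row B 2 (chart p) != 0 /\
   forall i, affine_row B i (chart p) / affine_row B 2 (chart p) =
   twist b (isom b A (vpick (val p)) i 0 / isom b A (vpick (val p)) 2 0).
  have hv := memv_pick (val p); have v0 := vpick_neq0 p.
  have v2 := coord2_neq0 hv v0.
  have e i : (B *m vpick (val p)) i 0 = twist b (isom b A (vpick (val p)) i 0).
    by rewrite /isom -[in LHS](map_twistK b (vpick _)) -map_mxM mxE.
  have w2 : isom b A (vpick (val p)) 2 0 != 0.
    exact: coord2_neq0 (motion_mem b uA hv) (isom_neq0 b uA v0).
  rewrite /chart; split=> [|i]; rewrite !affine_rowE // !e.
    by rewrite mulf_neq0 ?invr_eq0 // fmorph_eq0.
  by rewrite fmorph_div invf_div mulrA divfK.
split=> p; have [d0 e] := den p.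
  rewrite !e (chartE (motion_mem b uA (memv_pick _)) (isom_neq0 b uA (vpick_neq0 p))).
  by [].
have dinv : differentiable (fun z => (affine_row B 2 z)^-1) (chart p).
  by apply: differentiableV; [exact: differentiable_affine_row|].
have dquo i : differentiable (fun z => affine_row B i z / affine_row B 2 z) (chart p).
  by apply: differentiableM; [exact: differentiable_affine_row|].
by apply: differentiable_pair; exact: dquo.
Qed.

Lemma motion_holomorphic (A : 'M[C]_3) : U21 A -> holomorphic (motion false A).
Proof.
move=> /(motion_differentiable false) [F [h1 h2]]; exists F; split=> // p.
Qed.

Lemma motion_antiholomorphic (A : 'M[C]_3) : U21 A -> antiholomorphic (motion true A).
Proof.
by move=> /(motion_differentiable true) [F [h1 h2]]; exists F.
Qed.

Definition vec3 (x y z : C) : V := \col_i [:: x; y; z]`_i.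

Lemma herm_vec3 x y z x' y' z' :
  herm (vec3 x y z) (vec3 x' y' z') = x * z'^* + y * y'^* + z * x'^*.
Proof. by rewrite /herm !mxE. Qed.

Lemma vec3D x y z x' y' z' :
  vec3 x y z + vec3 x' y' z' = vec3 (x + x') (y + y') (z + z').
Proof. by apply/matrixP => i j; rewrite !mxE; case: i => [[|[|[]]]]. Qed.

Lemma vec3Z c x y z : c *: vec3 x y z = vec3 (c * x) (c * y) (c * z).
Proof. by apply/matrixP => i j; rewrite !mxE; case: i => [[|[|[]]]]. Qed.

Lemma vec3_inj x y z x' y' z' :
  vec3 x y z = vec3 x' y' z' -> [/\ x = x', y = y' & z = z'].
Proof.
move=> /matrixP e; split.
- by have := e 0 0; rewrite !mxE.
- by have := e 1 0; rewrite !mxE.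
- by have := e 2 0; rewrite !mxE.
Qed.

Lemma vec3E (v : V) : v = vec3 (v 0 0) (v 1 0) (v 2 0).
Proof.
apply/matrixP => i j; rewrite !mxE ord1.
by case: i => [[|[|[]]]] //= hi; congr (v _ 0); apply: val_inj.
Qed.

Lemma conj_vec3 x y z : map_mx (twist true) (vec3 x y z) = vec3 x^* y^* z^*.
Proof. by apply/matrixP => i j; rewrite !mxE; case: i => [[|[|[]]]]. Qed.

(** The vectors that represent the first axis of the chart near (-1, 0). *)
Lemma herm_near (h : C) : h + h^* < 2 -> herm (vec3 (-1 + h) 0 1) (vec3 (-1 + h) 0 1) < 0.
Proof.
rewrite herm_vec3 mul0r conjC1 rmorphD rmorphN /= conjC1 => hh.
have -> : (-1 + h) * 1 + 0 + 1 * (-1 + h^*) = h + h^* - 2 by ring.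
by rewrite subr_lt0.
Qed.

(** In the chart this is conjugation of both coordinates, which is not differentiable at (-1, 0):
along the first axis the difference quotient is h^- / h, equal to 1 for real h and to -1 for
imaginary h. *)
Lemma conjugation_not_holomorphic : ~ holomorphic (motion true (1%:M : 'M[C]_3)).
Proof.
move=> [F [F1 F2]].
have u1 : U21 (1%:M : 'M[C]_3) by move=> Z W; rewrite !mul1mx.
have FE (h : C) : h + h^* < 2 -> F (-1 + h, 0) = (-1 + h^*, 0).
  move=> hh; have hn := herm_near hh.
  set v := vec3 _ _ _ in hn.
  have v0 : v != 0 by apply: contraTneq hn => ->; rewrite herm0l ltxx.
  have hv : v \in val (negative_point hn) by exact: memv_line.
  have := F1 (negative_point hn); rewrite (chartE hv v0).
  rewrite (chartE (motion_mem true u1 hv) (isom_neq0 true u1 v0)).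
  rewrite /isom mul1mx conj_vec3 !mxE /= conjC0 conjC1 rmorphD rmorphN /= conjC1.
  by rewrite !divr1.
have h00 : (0 : C) + 0^* < 2 by rewrite conjC0 addr0 ltr0n.
have hn := herm_near h00; set v := vec3 _ _ _ in hn.
have v0 : v != 0 by apply: contraTneq hn => ->; rewrite herm0l ltxx.
have hv : v \in val (negative_point hn) by exact: memv_line.
pose e1 : (C^o * C^o)%type := (1, 0).
pose a : (C^o * C^o)%type := (-1, 0).
have Fa : F a = a by rewrite /a -[-1]addr0 FE // conjC0.
have dF : differentiable F a.
  by have := F2 (negative_point hn); rewrite (chartE hv v0) !mxE /= addr0 mul0r divr1.
have /cvg_ex [l hl] := @diff_derivable _ _ _ F a e1 dF.
have : (fun h : C^o => ((h^-1 *: ((F \o shift a) (h *: e1) - F a)).1 : C^o)) @ (0 : C^o)^' --> l.1.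
  by apply: cvg_comp hl _; exact: cvg_fst.
move/cvgrPdist_lt => /(_ 1 ltr01) /nbhs_ballP [d /= d0 hd].
have key (h : C) : h != 0 -> `|h| < d -> h + h^* < 2 -> `|l.1 - h^* / h| < 1.
  move=> h0 hh h2; have := hd h; rewrite /ball /= sub0r normrN => /(_ hh h0).
  have -> : h *: e1 + a = (-1 + h, 0).
    congr (_, _); first by change (h * 1 - 1 = -1 + h :> C); rewrite mulr1 addrC.
    by change (h * 0 + 0 = 0 :> C); rewrite mulr0 addr0.
  rewrite FE // Fa; congr (_ < 1); congr `|_ - _|.
  change (h^-1 * (-1 + h^* - -1) = h^* / h :> C).
  by rewrite opprK addrAC addNr add0r mulrC.
(* The increments r and i r: r lies below d, and below 1 so that the points are negative. *)
pose r : C := d / (1 + d).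
have d1 : 0 < 1 + d by rewrite addr_gt0.
have r0 : 0 < r by rewrite divr_gt0.
have rc : r^* = r by apply/CrealP/gtr0_real.
have rd : r < d by rewrite ltr_pdivrMr // mulrDr mulr1 ltrDl mulr_gt0.
have r1 : r < 1 by rewrite ltr_pdivrMr // mul1r ltrDr.
have k1 : `|l.1 - 1| < 1.
  have := key r; rewrite rc divff ?gt_eqF // gtr0_norm //; apply=> //.
  by rewrite -[2]/(1 + 1) ltrD.
have k2 : `|l.1 + 1| < 1.
  have := key ('i * r); rewrite mulf_neq0 ?neq0Ci ?gt_eqF // normrM normCi mul1r.
  rewrite gtr0_norm // rmorphM /= conjCi rc mulNr addrN mulNr divff.
    by rewrite opprK; apply=> //; rewrite ltr0n.
  by rewrite mulf_neq0 ?neq0Ci ?gt_eqF.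
have : `|(l.1 + 1) - (l.1 - 1)| < 1 + 1.
  by apply: le_lt_trans (ler_normB _ _) (ltrD k2 k1).
have -> : l.1 + 1 - (l.1 - 1) = 1 + 1 by ring.
by rewrite -[1 + 1]/(2%:R) normr_nat ltxx.
Qed.

Lemma not_holomorphic_motion (A Ai : 'M[C]_3) : U21 A -> U21 Ai -> Ai *m A = 1%:M ->
  ~ holomorphic (motion true A).
Proof.
move=> uA ui e hA; apply: conjugation_not_holomorphic.
have [F [F1 F2]] := hA; have [G [G1 G2]] := motion_holomorphic ui.
have eq1 : motion true (1%:M : 'M[C]_3) = motion false Ai \o motion true A.
  rewrite (motion_comp false true ui uA); congr motion; rewrite -e; congr (_ *m _).
  by apply/matrixP => i j; rewrite !mxE.
rewrite eq1; exists (G \o F); split=> p; first by rewrite /= F1 G1.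
by apply: differentiable_comp; [exact: F2|rewrite F1; exact: G2].
Qed.

(** * Real reflections *)
Section RealReflection.
Variable A : 'M[C]_3.
Hypothesis uA : U21 A.
Hypothesis invA : A *m map_mx (twist true) A = 1%:M.
Local Notation tau := (isom true A).

Lemma tauK : involutive tau.
Proof.
by move=> v; rewrite isom_comp invA isomFE mul1mx.
Qed.

(** Hilbert 90 for matrices: B = z^- A + z satisfies A B^- = B for every scalar z. It is invertible
when - z / z^- is not an eigenvalue of A, and the numbers z = 1 + i n give infinitely many values
of this quotient. *)
Lemma fixed_basis : exists2 B : 'M[C]_3, B \in unitmx &
  A *m map_mx (twist true) B = B.
Proof.
pose z (n : nat) : C := 1 + 'i * n%:R.
have zc n : (z n)^* = 1 - 'i * n%:R.
  by rewrite rmorphD rmorphM /= conjCi conjC1 conjC_nat mulNr.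
have iN n : 'i * n%:R != 1 :> C /\ 'i * n%:R != -1 :> C.
  have h (c : C) : c \is Num.real -> c != 0 -> 'i * n%:R != c.
    move=> cr c0; apply/eqP => e; move/CrealP: (cr); rewrite -e rmorphM /= conjCi conjC_nat.
    by rewrite mulNr e => /eqP; rewrite eqNr (negbTE c0).
  by split; apply: h; rewrite ?oppr_eq0 ?oner_eq0 ?realN ?real1.
have z0 n : z n != 0.
  by have [_ h] := iN n; rewrite /z addrC addr_eq0.
have zc0 n : (z n)^* != 0 by rewrite conjC_eq0.
pose a n := - z n / (z n)^*.
have a_inj : injective a.
  move=> m n /eqP; rewrite /a eqr_div // !zc /z mulNr mulNr eqr_opp => /eqP e.
  have : 'i * m%:R = 'i * n%:R :> C.
    apply: (@mulfI _ 2%:R); first by rewrite pnatr_eq0.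
    by apply/eqP; rewrite -subr_eq0; apply/eqP; move/eqP: e; rewrite -subr_eq0 => /eqP <-; ring.
  by move/(mulfI (neq0Ci _))/eqP; rewrite eqr_nat => /eqP.
have [n hn] : exists n, ~~ root (char_poly A) (a n).
  apply: contrapT => hno.
  have hall n : root (char_poly A) (a n) by apply: contrapT => h; apply: hno; exists n; apply/negP.
  have p0 : char_poly A != 0 by apply: monic_neq0; exact: char_poly_monic.
  have hall' : all (root (char_poly A)) [seq a n | n <- iota 0 4].
    by apply/allP => x /mapP [k _ ->].
  have huniq : uniq [seq a n | n <- iota 0 4] by rewrite map_inj_uniq ?iota_uniq.
  by have := max_poly_roots p0 hall' huniq; rewrite size_char_poly.
have hu : A - (a n)%:M \in unitmx.
  rewrite -row_free_unit -kermx_eq0.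
  by move: hn; rewrite -eigenvalue_root_char /eigenvalue negbK.
exists ((z n)^* *: (A - (a n)%:M)).
  by rewrite unitmxZ // unitfE.
have eB : (z n)^* *: (A - (a n)%:M) = (z n)^* *: A + (z n)%:M.
  by rewrite scalerBr scale_scalar_mx /a mulrC divfK // raddfN opprK.
rewrite eB map_mxD map_mxZ map_scalar_mx /= conjCK mulmxDr -scalemxAr invA.
by rewrite mul_mx_scalar scalemx1 addrC.
Qed.

Definition fixed_space : set V := [set v | tau v = v].

Lemma fixed_space_real : real_3_subspace fixed_space.
Proof.
have [B uB eB] := fixed_basis.
pose vec (r : 'I_3 -> R) : V := \col_k (r k)%:C%C.
have sumE (r : 'I_3 -> R) : \sum_k ((r k)%:C)%C *: col k B = B *m vec r.
  apply/matrixP => i j; rewrite !mxE summxE; apply: eq_bigr => k _.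
  by rewrite !mxE mulrC.
have vec_conj r : map_mx (twist true) (vec r) = vec r.
  by apply/matrixP => i j; rewrite !mxE /=; apply/CrealP/complex_realP; exists (r i).
exists (fun k => col k B); split.
  move=> r; rewrite sumE => /(congr1 (mulmx (invmx B))).
  rewrite mulKmx // mulmx0 => /matrixP e k; have := e k 0; rewrite !mxE.
  by move/complexI.
apply/seteqP; split=> v /=.
  rewrite /fixed_space /= => hv.
  have [x ev] : exists x, v = B *m x by exists (invmx B *m v); rewrite mulKVmx.
  have ex : map_mx (twist true) x = x.
    apply: (can_inj (mulKmx uB)); rewrite -ev.
    by rewrite -[RHS]hv /isom ev map_mxM mulmxA eB.
  exists (fun k => complex.Re (x k 0)) => //; rewrite sumE ev; congr (_ *m _).
  apply/matrixP => i j; rewrite !mxE ord1 RRe_real //; apply/CrealP.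
  by move/matrixP: ex => /(_ i 0); rewrite !mxE.
move=> [r _ <-]; rewrite sumE /fixed_space /= /isom map_mxM mulmxA eB.
by rewrite vec_conj.
Qed.

(** For a negative u, the vectors u + tau u and i (u - tau u) are fixed and their norms add up to
4 <u, u>; so one of them is negative. *)
Lemma fixed_space_negative : exists2 v, fixed_space v & herm v v < 0.
Proof.
have h00 : (0 : C) + 0^* < 2 by rewrite conjC0 addr0 ltr0n.
have := herm_near h00; set u := vec3 _ _ _ => hu.
pose w := u + tau u; pose w' := 'i *: (u - tau u).
have fw : tau w = w by rewrite /w isomD tauK addrC.
have fw' : tau w' = w'.
  rewrite /w' isomZ isomD -scaleN1r isomZ tauK /= conjCi rmorphN rmorph1 !scaleN1r.
  by rewrite scaleNr -scalerN opprD opprK addrC.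
have real_uu : (herm u u)^* = herm u u by rewrite herm_conj.
have tt : herm (tau u) (tau u) = herm u u by rewrite isom_herm.
have sum : herm w w + herm w' w' = 4%:R * herm u u.
  rewrite /w' hermZ conjCi mulrN -expr2 sqrCi opprK mul1r.
  rewrite /w !hermDl !hermDr !hermNl !hermNr tt; ring.
have w_real : herm w w \is Num.real by apply/CrealP; rewrite herm_conj.
have [hw|hw] := real_ltP w_real (real0 C); first by exists w.
exists w' => //; rewrite -(ltrD2l (herm w w)) sum addr0.
by apply: lt_le_trans hw; rewrite pmulr_rlt0 // ltr0n.
Qed.

(** A fixed line is spanned by a fixed vector: by u + tau u, or by i u if this vanishes. *)
Lemma reflection_real : real_reflection (motion true A).
Proof.
split.
- exact: motion_antiholomorphic.
- exact: motion_isometric.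
- move=> p; have := motion_comp true true uA uA; rewrite invA motion1.
  by move/(congr1 (fun f => f p)).
exists fixed_space; split; first exact: fixed_space_real.
- move=> v w hv hw; apply/CrealP.
  by rewrite -[in RHS]hv -[in RHS]hw isom_herm.
- exact: fixed_space_negative.
apply/seteqP; split=> p /=.
  move=> hp; have hu := memv_pick (val p); have u0 := vpick_neq0 p.
  have htu : tau (vpick (val p)) \in val p by rewrite -[in X in _ \in X]hp; apply: motion_mem.
  have [w0|w0] := eqVneq (vpick (val p) + tau (vpick (val p))) 0.
    exists ('i *: vpick (val p)); split.
    - rewrite /fixed_space /= isomZ /= conjCi scaleNr -scalerN; congr (_ *: _).
      by apply/eqP; rewrite eq_sym -addr_eq0 w0.
    - by rewrite scaler_eq0 negb_or neq0Ci.
    - by rewrite memvZ.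
  exists (vpick (val p) + tau (vpick (val p))); split=> //; last exact: memvD.
  by rewrite /fixed_space /= isomD tauK addrC.
move=> [v [hv v0 vp]]; apply: (H2C_eq (v := v)) => //.
by rewrite -[v]hv; apply: motion_mem.
Qed.

End RealReflection.

Lemma motion_scale b (A : 'M[C]_3) (c : C) : U21 A -> U21 (c *: A) -> c != 0 ->
  motion b (c *: A) = motion b A.
Proof.
move=> uA ucA c0; apply/funext => p.
have hv := memv_pick (val p); have v0 := vpick_neq0 p.
apply: (H2C_eq (v := isom b (c *: A) (vpick (val p)))).
- exact: motion_mem.
- by rewrite /isom -scalemxAl memvZ // motion_mem.
- exact: isom_neq0.
Qed.

Lemma vec3_neg_neq0 (v : V) : herm v v < 0 -> v != 0.
Proof. by apply: contraTneq => ->; rewrite herm0l ltxx. Qed.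

(** If A and B induce the same map, B v = c A v for each negative v, with c depending on v. The
vectors n1, n2, n3 form a basis, and n1, n2, n3, n1 + n2, n1 + n3 are all negative, which forces
the same c on the whole basis. *)
Lemma motion_faithful (A B : 'M[C]_3) : U21 A -> U21 B ->
  motion false A = motion false B -> exists c, B = c *: A.
Proof.
move=> uA uB eAB.
have prop (v : V) : herm v v < 0 -> exists c, B *m v = c *: (A *m v).
  move=> hv; have v0 := vec3_neg_neq0 hv.
  have hp : v \in val (negative_point hv) by exact: memv_line.
  have := motion_mem false uB hp; rewrite -eAB (motion_val false uA hp v0).
  by rewrite !isomFE => /vlineP.
have same (u v : V) (c d : C) : herm (u + v) (u + v) < 0 ->
    (forall a b : C, a *: u + b *: v = 0 -> a = 0 /\ b = 0) ->
    B *m u = c *: (A *m u) -> B *m v = d *: (A *m v) -> c = d.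
  move=> huv ind eu ev; have [e he] := prop _ huv.
  have : (e - c) *: u + (e - d) *: v = 0.
    apply: (isom_inj uA (b := false)); rewrite isom0 isomFE mulmxDr -!scalemxAr.
    rewrite !scalerBl -eu -ev addrACA -scalerDr -mulmxDr -he -opprD -mulmxDr.
    by rewrite subrr.
  by case/ind => /subr0_eq <- /subr0_eq <-.
pose n1 := vec3 (-1 : C) 0 1; pose n2 := vec3 (-2%:R : C) 0 1.
pose n3 := vec3 (-1 : C) 1 1.
have cn (k : nat) : (- k%:R : C)^* = - k%:R by rewrite rmorphN /= conjC_nat.
have neg (x y z : nat) : (y * y < 2 * (x * z))%N ->
    herm (vec3 (- x%:R) y%:R z%:R) (vec3 (- x%:R : C) y%:R z%:R) < 0.
  move=> h; rewrite herm_vec3 cn !conjC_nat.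
  have -> : - x%:R * z%:R + y%:R * y%:R + z%:R * - x%:R =
    (y * y)%:R - (2 * (x * z))%:R :> C by rewrite !natrM; ring.
  by rewrite subr_lt0 ltr_nat.
have h1 : herm n1 n1 < 0 by have := @neg 1 0 1 isT.
have h2 : herm n2 n2 < 0 by have := @neg 2 0 1 isT.
have h3 : herm n3 n3 < 0 by have := @neg 1 1 1 isT.
have [c1 e1] := prop _ h1; have [c2 e2] := prop _ h2; have [c3 e3] := prop _ h3.
have two : 1 + 1 = 2%:R :> C by [].
have e12 : c1 = c2.
  apply: (same n1 n2) e1 e2.
    rewrite vec3D -opprD addr0 two; have -> : 1 + 2%:R = 3%:R :> C by ring.
    exact: (@neg 3 0 2 isT).
  move=> a b; rewrite !vec3Z vec3D => /esym/esym; rewrite (vec3E 0) !mxE.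
  case/vec3_inj=> h _ h'; have ea : a = - b by apply/eqP; rewrite -addr_eq0 -[a]mulr1 -[b]mulr1 h'.
  have eb : b = 0 by move: h; rewrite ea => h; rewrite -[RHS]oppr0 -h; ring.
  by rewrite ea eb oppr0.
have e13 : c1 = c3.
  apply: (same n1 n3) e1 e3.
    rewrite vec3D -opprD add0r two; exact: (@neg 2 1 2 isT).
  move=> a b; rewrite !vec3Z vec3D => /esym/esym; rewrite (vec3E 0) !mxE.
  case/vec3_inj=> h; rewrite mulr0 mulr1 add0r => b0.
  by rewrite b0 mulr1 addr0.
exists c1; apply/matrixP => i j.
have key (v : V) : B *m v = c1 *: (A *m v).
  have -> : v = (v 0 0 + 2%:R * v 2 0 - v 1 0) *: n1 + (- (v 0 0 + v 2 0)) *: n2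
                + v 1 0 *: n3.
    rewrite {1}[v]vec3E !vec3Z !vec3D; congr vec3; ring.
  rewrite !mulmxDr -!scalemxAr e1 e2 e3 -e12 -e13.
  by rewrite !scalerDr ![c1 *: (_ *: _)]scalerA ![_ *: (c1 *: _)]scalerA ![_ * c1]mulrC.
have := key (delta_mx j 0); rewrite -!colE => /matrixP /(_ i 0).
by rewrite !mxE.
Qed.

End ComplexPlane.

(** * Groups generated by involutions *)
Section InvolutionGroups.
Variables (X : Type) (S : set (X -> X)).
Hypothesis invS : forall s, S s -> involutive s.

(** The boolean is the parity of the number of factors. *)
Inductive alternating_word : bool -> (X -> X) -> Prop :=
| alternating_id : alternating_word false id
| alternating_step b s f : S s -> alternating_word b f -> alternating_word (~~ b) (s \o f).

Lemma alternating_comp b c f g :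
  alternating_word b f -> alternating_word c g -> alternating_word (b (+) c) (f \o g).
Proof.
move=> hf hg; elim: hf => [|b' s f' Ss _ IH]; first by rewrite addFb.
by rewrite addNb -compA; apply: alternating_step.
Qed.

Lemma alternating_gen s : S s -> alternating_word true s.
Proof. by move=> Ss; have := alternating_step Ss alternating_id. Qed.

Lemma alternating_inv b f : alternating_word b f ->
  exists2 g, alternating_word b g & cancel f g /\ cancel g f.
Proof.
elim=> [|{}b s {}f Ss hf [g hg [fK gK]]]; first by exists id => //; exact: alternating_id.
exists (g \o s).
  by rewrite -addbT; apply: alternating_comp (alternating_gen Ss).
by split=> x /=; rewrite ?(invS Ss) ?fK ?gK ?(invS Ss).
Qed.

Lemma generated_alternating : generated S = [set f | exists b, alternating_word b f].
Proof.
apply/seteqP; split=> f /=.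
  move: f; apply: smallest_sub; last by move=> s Ss /=; exists true; exact: alternating_gen.
  split=> [|f g [b hf] [c hg]|f [b /alternating_inv [g hg fg]]].
  - by exists false; exact: alternating_id.
  - by exists (b (+) c); exact: alternating_comp.
  - by exists g => //; exists b.
move=> [b hf] G /= [[G1 GM _] SG]; elim: hf => // {}b s {}f Ss _ Gf.
by apply: GM => //; apply: SG.
Qed.

Lemma alternating_index s0 : S s0 ->
  (forall f, alternating_word true f -> ~ alternating_word false f) ->
  has_index [set f | alternating_word false f] (generated S) 2.
Proof.
move=> Ss0 disj; pose co (i : nat) := if i is 0%N then id else s0.
rewrite /has_index.
have -> : [set [set g \o h | h in [set f | alternating_word false f]] | g in generated S] =
  [set [set co i \o h | h in [set f | alternating_word false f]] | i in `I_2].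
  rewrite generated_alternating; apply/seteqP; split=> Y /=.
    move=> [g [b hg] <-].
    have hco : alternating_word b (co b) by case: (b); [exact: alternating_gen|exact: alternating_id].
    exists (b : nat); first by case: (b).
    have [g' hg' [gK g'K]] := alternating_inv hg.
    have [c hc [cK c'K]] := alternating_inv hco.
    apply/seteqP; split=> f /= [h hh <-].
      exists (g' \o co b \o h); last by apply/funext => x /=; rewrite g'K.
      by have := alternating_comp (alternating_comp hg' hco) hh; rewrite addbb.
    exists (c \o g \o h); last by apply/funext => x /=; rewrite c'K.
    by have := alternating_comp (alternating_comp hc hg) hh; rewrite addbb.
  move=> [i hi <-]; exists (co i) => //.
  by case: i hi => [|[|]] // _; [exists false; exact: alternating_id|
     exists true; exact: alternating_gen].
apply: inj_card_eq => i j; rewrite !inE /= => hi hj e.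
have mem (k : nat) : [set co k \o h | h in [set f | alternating_word false f]] (co k).
  by exists id => //; exact: alternating_id.
have := mem i; rewrite e => -[h hh eh].
case: i j hi hj eh {e mem} => [|[|i]] [|[|j]] //= _ _ eh.
  case: (disj id); last exact: alternating_id.
  by rewrite -eh; have := alternating_comp (alternating_gen Ss0) hh.
by case: (disj s0); [exact: alternating_gen|rewrite -eh].
Qed.

End InvolutionGroups.

(** Counting cosets by representatives. *)
Section IndexLemma.
Variables (X : Type) (H G : set (X -> X)) (n : nat) (rep : nat -> X -> X).
Hypothesis groupH : transformation_group H.
Hypothesis repG : forall i, (i < n)%N -> G (rep i).
Hypothesis rep_cover : forall g, G g -> exists i, (i < n)%N /\ exists2 h, H h & g = rep i \o h.
Hypothesis rep_inj : forall i j h, (i < n)%N -> (j < n)%N -> H h -> rep i = rep j \o h -> i = j.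

Lemma has_index_reps : has_index H G n.
Proof.
have [H1 HM HV] := groupH.
have coset (g h : X -> X) : H h -> [set g \o h \o k | k in H] = [set g \o k | k in H].
  move=> Hh; apply/seteqP; split=> f /= [k Hk <-].
    by exists (h \o k) => //; exact: HM.
  have [h' Hh' [hK h'K]] := HV _ Hh.
  by exists (h' \o k); [exact: HM|apply/funext => x /=; rewrite h'K].
rewrite /has_index.
have -> : [set [set g \o h | h in H] | g in G] = [set [set rep i \o h | h in H] | i in `I_n].
  apply/seteqP; split=> Y /= [g hg <-].
    have [i [hi [h Hh ->]]] := rep_cover hg.
    by exists i => //; rewrite coset.
  by exists (rep g) => //; exact: repG.
apply: inj_card_eq => i j; rewrite !inE /= => hi hj e.
have : [set rep i \o h | h in H] (rep i) by exists id.
by rewrite e => -[h Hh eh]; apply: (rep_inj hi hj Hh).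
Qed.
End IndexLemma.

(** * The embedding of the integers into the complex numbers *)

(** Then X^2 - T X + N is the minimal polynomial of a generator of the ring of integers of
Q(sqrt(-d)). The fields concerned with T = 0 are those of d = 1 and d = 2. *)
Definition order_parameters (d : nat) (T N : Z) : Prop :=
  (T = 1 /\ Z.of_nat d = 4 * N - 1 \/ T = 0 /\ Z.of_nat d = N /\ (N = 1 \/ N = 2))%coqZ.

Section Embedding.
Variables (R : realType) (d : nat) (T N : Z).
Local Notation C := R[i].
Local Notation V := 'cV[C]_3.

Hypothesis order_type : order_parameters d T N.

Lemma order_discr : (0 < 4 * N - T * T)%coqZ.
Proof. by case: order_type => -[-> h]; lia. Qed.

Lemma order_parameters_TN : (T = 1 \/ T = 0 /\ (N = 1 \/ N = 2))%coqZ.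
Proof. by case: order_type => [[-> _]|[-> [_ h]]]; [left|right]. Qed.

Lemma order_parameters_gt0 : (0 < d)%N.
Proof. by case: order_type => -[_ h]; lia. Qed.

Definition zC (k : Z) : C := (int_of_Z k)%:~R.

Lemma zCD a b : zC (a + b)%coqZ = zC a + zC b.
Proof. by rewrite /zC -intrD; congr (_%:~R); exact: (rmorphD int_of_Z). Qed.
Lemma zCM a b : zC (a * b)%coqZ = zC a * zC b.
Proof. by rewrite /zC -intrM; congr (_%:~R); exact: (rmorphM int_of_Z). Qed.
Lemma zCN a : zC (- a)%coqZ = - zC a.
Proof. by rewrite /zC -rmorphN; congr (_%:~R); exact: (rmorphN int_of_Z). Qed.
Lemma zCB a b : zC (a - b)%coqZ = zC a - zC b.
Proof. by rewrite -zCN -zCD. Qed.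
Lemma zC0 : zC 0%coqZ = 0. Proof. by []. Qed.
Lemma zC1 : zC 1%coqZ = 1. Proof. by []. Qed.
Lemma zC_conj a : (zC a)^* = zC a.
Proof. by rewrite /zC rmorph_int. Qed.
Lemma zC_inj : injective zC.
Proof.
move=> a b /eqP; rewrite /zC eqr_int => /eqP; exact: (can_inj int_of_ZK).
Qed.
Lemma zC_nat n : zC (Z.of_nat n) = n%:R.
Proof. by rewrite /zC; have -> : int_of_Z (Z.of_nat n) = n by lia. Qed.

Definition sqrtd : C := sqrtC (- d%:R).

Lemma sqrtd_sq : sqrtd * sqrtd = - d%:R.
Proof. by rewrite -expr2 sqrtCK. Qed.

Lemma sqrtd_conj : sqrtd^* = - sqrtd.
Proof.
have : (sqrtd^*) ^+ 2 == sqrtd ^+ 2.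
  by rewrite -rmorphXn /= expr2 sqrtd_sq rmorphN /= conjC_nat.
rewrite eqf_sqr => /orP[/eqP/CrealP hr|/eqP //].
have : 0 <= sqrtd ^+ 2 by rewrite real_exprn_even_ge0.
by rewrite expr2 sqrtd_sq oppr_ge0 lern0 eqn0Ngt order_parameters_gt0.
Qed.

Definition omega : C := if (T =? 1)%coqZ then (1 + sqrtd) / 2%:R else sqrtd.

Lemma sqrtdE : sqrtd = 2%:R * omega - 1 /\ T = 1%coqZ \/ sqrtd = omega /\ T = 0%coqZ.
Proof.
rewrite /omega; case: order_type => -[-> _] /=; [left|right] => //.
by split=> //; field.
Qed.

Lemma omega_sq : omega * omega = zC T * omega - zC N.
Proof.
rewrite /omega; have := sqrtd_sq; rewrite -zC_nat.
case: order_type => [[-> ->]|[-> [-> _]]]; cbn [Z.eqb Pos.eqb]; rewrite ?zC1 ?zC0 ?(zCD, zCB, zCN, zCM).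
  have -> : zC 4 = 4%:R by []. have -> : zC 1 = 1 by [].
  move=> h; apply: (mulfI (x := 4%:R)); first by rewrite pnatr_eq0.
  have -> : 4%:R * ((1 + sqrtd) / 2%:R * ((1 + sqrtd) / 2%:R)) =
    1 + 2%:R * sqrtd + sqrtd * sqrtd :> C by field.
  by rewrite h; field.
by move=> ->; rewrite mul0r add0r.
Qed.

Lemma omega_conj : omega^* = zC T - omega.
Proof.
rewrite /omega; case: order_type => -[-> _] /=.
  by rewrite rmorphM fmorphV /= rmorphD /= conjC1 conjC_nat sqrtd_conj zC1; field.
by rewrite sqrtd_conj zC0 sub0r.
Qed.

Definition oembed (x : oint) : C := zC x.1 + zC x.2 * omega.

Lemma oembedD x y : oembed (oadd x y) = oembed x + oembed y.
Proof. by rewrite /oembed /= !zCD; ring. Qed.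

Lemma oembedM x y : oembed (omul T N x y) = oembed x * oembed y.
Proof.
rewrite /oembed /omul; cbn [fst snd]; rewrite !(zCD, zCB, zCN, zCM).
have -> : (zC x.1 + zC x.2 * omega) * (zC y.1 + zC y.2 * omega) =
  zC x.1 * zC y.1 + (zC x.1 * zC y.2 + zC x.2 * zC y.1) * omega
  + zC x.2 * zC y.2 * (omega * omega) by ring.
by rewrite omega_sq; ring.
Qed.

Lemma oembed_conj x : oembed (oconj T x) = (oembed x)^*.
Proof.
rewrite /oembed /oconj; cbn [fst snd]; rewrite rmorphD rmorphM /= !zC_conj omega_conj.
by rewrite !(zCD, zCB, zCN, zCM); ring.
Qed.

Lemma oembed0 : oembed ozero = 0. Proof. by rewrite /oembed /= zC0 mul0r addr0. Qed.
Lemma oembed1 : oembed oone = 1. Proof. by rewrite /oembed /= zC0 mul0r addr0. Qed.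

Lemma oembed_inj : injective oembed.
Proof.
suff h x : oembed x = 0 -> x = ozero.
  move=> x y e; have : oembed (osub x y) = 0.
    have -> : osub x y = oadd x (oopp y) by [].
    rewrite oembedD e -oembedD; have -> : oadd y (oopp y) = ozero.
      by apply: oint_eq; rewrite /oadd /oopp /=; lia.
    exact: oembed0.
  move/h => [h1 h2]; apply: oint_eq; lia.
move=> e; have ec : oembed (oconj T x) = 0 by rewrite oembed_conj e conjC0.
have : oembed x * oembed (oconj T x) = 0 by rewrite e mul0r.
rewrite -oembedM onormE /oembed /= zC0 mul0r addr0 -zC0 => /zC_inj h.
exact: (onorm_eq0 order_discr h).
Qed.

Definition toC (A : mat) : 'M[C]_3 :=
  \matrix_(i, j) oembed (nth ozero (nth [::]
    [:: [:: m11 A; m12 A; m13 A]; [:: m21 A; m22 A; m23 A]; [:: m31 A; m32 A; m33 A]]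
    i) j).

Lemma forall_I3 (P : 'I_3 -> Prop) : P 0 -> P 1 -> P 2 -> forall i, P i.
Proof.
move=> h0 h1 h2 [[|[|[|]]] // hi].
- by have -> : Ordinal hi = 0 by exact: val_inj.
- by have -> : Ordinal hi = 1 by exact: val_inj.
- by have -> : Ordinal hi = 2 by exact: val_inj.
Qed.

Lemma sum_I3 (F : 'I_3 -> C) : \sum_i F i = F 0 + F 1 + F 2.
Proof.
rewrite !big_ord_recl big_ord0 addr0 addrA; congr (_ + _ + _); congr F; exact: val_inj.
Qed.

Lemma toCM A B : toC (mmul T N A B) = toC A *m toC B.
Proof.
apply/matrixP; elim/forall_I3; elim/forall_I3; rewrite !mxE sum_I3 !mxE /=;
  case: A => *; case: B => * /=; by rewrite /dot !(oembedD, oembedM) addrA.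
Qed.

Lemma toC1 : toC mone = 1%:M.
Proof.
by apply/matrixP; elim/forall_I3; elim/forall_I3; rewrite !mxE /= ?oembed0 ?oembed1.
Qed.

Lemma toC_conj A : toC (mconj T A) = map_mx (twist R true) (toC A).
Proof.
by apply/matrixP; elim/forall_I3; elim/forall_I3; rewrite !mxE /=; case: A => *;
  rewrite /= oembed_conj.
Qed.

Lemma toC_scale u A : toC (smat T N u A) = oembed u *: toC A.
Proof.
by apply/matrixP; elim/forall_I3; elim/forall_I3; rewrite !mxE /=; case: A => *;
  rewrite /= oembedM.
Qed.

Lemma toC_inj : injective toC.
Proof.
move=> A B /matrixP e.
by apply: mat_eq; apply: oembed_inj;
 [have := e 0 0|have := e 0 1|have := e 0 2|have := e 1 0|have := e 1 1|have := e 1 2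
 |have := e 2 0|have := e 2 1|have := e 2 2]; rewrite !mxE.
Qed.

Lemma herm_star A (Z W : V) : herm (toC A *m Z) W = herm Z (toC (mstar T A) *m W).
Proof.
rewrite /herm !mxE !sum_I3 !mxE; case: A => x y z x' y' z' x'' y'' z'' /=.
rewrite !oembed_conj; move: (oembed x) (oembed y) (oembed z) (oembed x') (oembed y') (oembed z').
move: (oembed x'') (oembed y'') (oembed z'') => *.
by rewrite !rmorphD !rmorphM /= !conjCK; ring.
Qed.

Lemma unitary_U21 A : unitary T N A <-> U21 (toC A).
Proof.
split=> [[h _] Z W|uA].
  by rewrite herm_star mulmxA -toCM h toC1 mul1mx.
have h : toC (mstar T A) *m toC A = 1%:M.
  apply/matrixP => i j.
  have key (W : V) : toC (mstar T A) *m toC A *m W = W.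
    apply/eqP; rewrite -subr_eq0; apply/eqP/herm_nondeg => Z.
    rewrite -herm_conj hermDr hermNr -mulmxA -herm_star uA subrr conjC0; by [].
  have := key (delta_mx j 0); rewrite -colE => /matrixP /(_ i 0).
  by rewrite !mxE eqxx andbT.
split; apply: toC_inj; rewrite toCM toC1 //; exact: mulmx1C.
Qed.

End Embedding.

(** By the lemma of Gauss, X - q is up to a scalar an integral factor of a monic integral
polynomial, hence its leading coefficient is invertible. *)
Lemma rat_integral (F : numFieldType) (q : rat) :
  integralOver (intr : int -> F) (ratr q) -> exists n : int, q = n%:~R.
Proof.
move=> [p p_mon]; have -> : map_poly (intr : int -> F) p =
    map_poly (ratr : rat -> F) (map_poly (intr : int -> rat) p).
  by rewrite -map_poly_comp; apply: eq_map_poly => n /=; rewrite ratr_int.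
rewrite fmorph_root -dvdp_XsubCl => /dvdpP_rat_int [p1 [a a0 e] [r er]].
have l1 : lead_coef p1 * lead_coef r = 1 by rewrite -lead_coefM -er; apply/monicP.
have s1 : size p1 = 2.
  have := size_XsubC q; rewrite e size_scale // size_map_inj_poly //.
  exact: intr_inj.
have lE : lead_coef p1 = p1`_1 by rewrite lead_coefE s1.
have e1 : 1 = a * (p1`_1)%:~R.
  by have := congr1 (fun s : {poly rat} => s`_1) e; rewrite coefB coefX coefC coefZ coef_map /= subr0.
have e0 : - q = a * (p1`_0)%:~R.
  by have := congr1 (fun s : {poly rat} => s`_0) e; rewrite coefB coefX coefC coefZ coef_map /= sub0r.
rewrite lE in l1.
exists (- (lead_coef r * p1`_0)).
have ea : a = (lead_coef r)%:~R.
  have <- : a * (p1`_1 * lead_coef r)%:~R = a by rewrite l1 mulr1.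
  by rewrite intrM mulrA -e1 mul1r.
by rewrite mulrNz intrM -ea -e0 opprK.
Qed.

Lemma squarefree_rat (d : nat) (q : rat) (k : int) :
  (forall m : nat, (m * m %| d)%N -> m = 1%N) ->
  d%:R * (q * q) = k%:~R -> exists n : int, q = n%:~R.
Proof.
move=> sqf e; exists (numq q).
suff h : `|denq q|%N = 1%N.
  have e1 : denq q = 1 by have := denq_gt0 q; lia.
  by rewrite -[LHS]divq_num_den e1 mulr1z divr1.
apply: sqf.
have e2 : d%:Z * (numq q * numq q) = k * (denq q * denq q).
  by apply: (@intr_inj rat); rewrite !intrM -e numqE; ring.
have co : coprime (`|denq q| * `|denq q|) (`|numq q| * `|numq q|).
  by rewrite coprimeMl !coprimeMr !(coprime_sym `|denq q|%N) !coprime_num_den.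
rewrite -(Gauss_dvdl _ co).
have -> : (d * (`|numq q| * `|numq q|) = `|k| * (`|denq q| * `|denq q|))%N.
  by rewrite -!abszM -e2 !abszM.
by rewrite dvdn_mull.
Qed.

Section RingOfIntegers.
Variables (R : realType) (d : nat) (T N : Z).
Local Notation C := R[i].
Hypothesis order_type : order_parameters d T N.
Hypothesis d_squarefree : forall m : nat, (m * m %| d)%N -> m = 1%N.

Local Notation oembed' := (@oembed R d T).
Local Notation sqrtd := (sqrtd R d).

Lemma oembed_integral x : ring_of_integers d (oembed' x).
Proof.
have intR (n : int) : integralOver (intr : int -> C) n%:~R by exact: integral_id.
split.
  have [[es _]|[es _]] := sqrtdE R order_type.
    exists ((int_of_Z x.1)%:~R + (int_of_Z x.2)%:~R / 2%:R), ((int_of_Z x.2)%:~R / 2%:R).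
    rewrite -/sqrtd es rmorphD fmorph_div /= !ratr_int ratr_nat /oembed /zC.
    by field.
  exists (int_of_Z x.1)%:~R, (int_of_Z x.2)%:~R.
  by rewrite !ratr_int -/sqrtd es.
apply: integral_add; first exact: intR.
apply: integral_mul; first exact: intR.
have := omega_sq R order_type; set w := omega _ _ _ => ew.
exists ('X * 'X - (int_of_Z T)%:P * 'X + (int_of_Z N)%:P).
  apply/monicP; rewrite -addrA lead_coefDl.
    by rewrite -expr2 lead_coefXn.
  rewrite -expr2 size_polyXn ltnS addrC.
  apply: leq_trans (size_polyD _ _) _; rewrite geq_max.
  rewrite (leq_trans (size_polyC_leq1 _)) //= size_polyN.
  by apply: leq_trans (size_polyMleq _ _) _; rewrite size_polyX addn2 /= ltnS size_polyC_leq1.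
apply/rootP; rewrite rmorphD rmorphB !rmorphM /= !map_polyC !map_polyX !hornerE ew.
by rewrite /zC; ring.
Qed.

(** If z = a + b sqrt(-d) is integral, so are its conjugate, its trace 2 a and its norm
a^2 + d b^2. As d is squarefree, A = 2 a and B = 2 b are integers, and A^2 + d B^2 is a multiple
of 4. If d = -1 mod 4 this says that A and B have the same parity; if d is 1 or 2, that both are
even. *)
Lemma ring_of_integers_oembed z : ring_of_integers d z -> exists x, z = oembed' x.
Proof.
move=> [[a [b ez]] [p p_mon pz]].
have int_z : integralOver (intr : int -> C) z by exists p.
have ez' : z^* = ratr a - ratr b * sqrtd.
  have cr (q : rat) : (ratr q : C)^* = ratr q by exact: fmorph_rat.
  have := cr a; have := cr b; rewrite ez -/sqrtd; move: (ratr a) (ratr b) => x y hy hx.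
  by rewrite rmorphD rmorphM /= hx hy (sqrtd_conj R order_type) mulrN.
rewrite -/sqrtd in ez.
have int_zc : integralOver (intr : int -> C) z^*.
  exists p => //.
  have -> : map_poly (intr : int -> C) p = map_poly Num.conj (map_poly (intr : int -> C) p).
    by rewrite -map_poly_comp; apply: eq_map_poly => n /=; rewrite rmorph_int.
  by rewrite fmorph_root.
have [A eA] : exists n : int, 2%:R * a = n%:~R.
  apply: (@rat_integral C); rewrite rmorphM /= ratr_nat.
  have -> : 2%:R * ratr a = z + z^* by rewrite ez' ez; ring.
  exact: integral_add.
have [M eM] : exists n : int, a * a + d%:R * (b * b) = n%:~R.
  apply: (@rat_integral C); rewrite rmorphD !rmorphM /= ratr_nat.
  have -> : ratr a * ratr a + d%:R * (ratr b * ratr b) = z * z^*.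
    rewrite ez' ez; have -> : (ratr a + ratr b * sqrtd) * (ratr a - ratr b * sqrtd) =
      ratr a * ratr a - ratr b * ratr b * (sqrtd * sqrtd) by ring.
    by rewrite sqrtd_sq; ring.
  exact: integral_mul.
have eB' : d%:R * (2%:R * b * (2%:R * b)) = (4%:Z * M - A * A)%:~R.
  rewrite rmorphB !rmorphM /= -eA -eM; ring.
have [B eB] := squarefree_rat d_squarefree eB'.
have eAB : (A * A + d%:Z * (B * B) = 4%:Z * M)%R.
  apply: (@intr_inj rat); rewrite rmorphD !rmorphM /= -eB eB' rmorphB !rmorphM /=; ring.
have half (q : rat) (n : int) : 2%:R * q = n%:~R -> ratr q = n%:~R / 2%:R :> C.
  move=> /(congr1 (ratr : rat -> C)); rewrite rmorphM /= ratr_nat ratr_int => <-.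
  by field.
have ea := half _ _ eA; have eb := half _ _ eB.
have [[es eT]|[es eT]] := sqrtdE R order_type.
  have [k ek] : exists k : int, A = B + 2%:Z * k.
    have ed : d%:Z = 4%:Z * int_of_Z N - 1 by case: order_type; lia.
    exists ((A - B) %/ 2%:Z)%Z.
    have := divz_eq (A - B) 2%:Z; have := modz_ge0 (A - B) (isT : 2%:Z != 0).
    have := ltz_mod (A - B) (isT : 2%:Z != 0); rewrite ed in eAB.
    move: (_ %/ _)%Z (_ %% _)%Z => q r h1 h2 h3.
    have [er|er] : r = 0 \/ r = 1 by lia.
      by lia.
    have e : A = B + 2%:Z * q + 1 by lia.
    by exfalso; move: eAB; rewrite e; nia.
  exists (Z_of_int k, Z_of_int B); rewrite /oembed /zC /= !Z_of_intK ez ea eb es ek.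
  by rewrite rmorphD rmorphM /=; field.
have [[k ek] [l el]] : (exists k : int, A = 2%:Z * k) /\ (exists l : int, B = 2%:Z * l).
  have ed : d%:Z = 1 \/ d%:Z = 2%:Z by case: order_type; lia.
  have par (n : int) : exists q : int, n = 2%:Z * q \/ n = 2%:Z * q + 1.
    exists (n %/ 2%:Z)%Z; have := divz_eq n 2%:Z.
    have := modz_ge0 n (isT : 2%:Z != 0); have := ltz_mod n (isT : 2%:Z != 0).
    by move: (_ %/ _)%Z (_ %% _)%Z => q r; lia.
  have [k ek] := par A; have [l el] := par B.
  suff [h1 h2] : A = 2%:Z * k /\ B = 2%:Z * l by split; [exists k|exists l].
  by case: ed => ed; rewrite ed in eAB; case: ek => ek; case: el => el //;
     exfalso; move: eAB; rewrite ek el; nia.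
exists (Z_of_int k, Z_of_int l); rewrite /oembed /zC /= !Z_of_intK ez ea eb es ek el.
by rewrite !rmorphM /=; field.
Qed.

End RingOfIntegers.

(** * Subgroups generated by real reflections *)
Section Assembly.
Variables (R : realType) (d : nat) (T N : Z).
Local Notation C := R[i].
Hypothesis order_type : order_parameters d T N.
Hypothesis d_squarefree : forall m : nat, (m * m %| d)%N -> m = 1%N.

Local Notation emb := (@oembed R d T).
Local Notation toC := (@toC R d T).
Local Notation mul := (mmul T N).
Local Notation star := (mstar T).
Local Notation conj := (mconj T).
Local Notation unitary := (unitary T N).

Let U21P M : unitary M <-> U21 (toC M) := unitary_U21 R order_type M.
Let toCM' := toCM R order_type.
Let toC_conj' := toC_conj R order_type.
Let toC_scale' u M : toC (smat T N u M) = emb u *: toC M := toC_scale R order_type u M.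

Definition omotion (b : bool) (M : mat) : H2C R -> H2C R := motion b (toC M).

Lemma omotion1 : omotion false mone = id.
Proof. by rewrite /omotion toC1 motion1. Qed.

Lemma omotionM b1 b2 M K : unitary M -> unitary K ->
  omotion b1 M \o omotion b2 K = omotion (b1 (+) b2) (mul M (if b1 then conj K else K)).
Proof.
move=> uM uK; rewrite /omotion (motion_comp b1 b2 (proj1 (U21P M) uM) (proj1 (U21P K) uK)).
congr motion.
rewrite toCM'; congr (_ *m _); case: (b1) => /=; first by rewrite toC_conj'.
by apply/matrixP => i j; rewrite !mxE.
Qed.

Lemma omotion_holomorphic M : unitary M -> holomorphic (omotion false M).
Proof. by move=> /U21P; exact: motion_holomorphic. Qed.

Lemma omotion_not_holomorphic M : unitary M -> ~ holomorphic (omotion true M).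
Proof.
move=> uM; apply: (@not_holomorphic_motion _ _ (toC (star M))).
- exact/U21P.
- exact/U21P/unitary_star.
- by rewrite -toCM' (proj1 uM) toC1.
Qed.

Lemma oembed_neq0 u M : unitary (smat T N u M) -> emb u != 0.
Proof.
move=> uM; apply: contraPneq (proj1 uM) => e h.
have : toC (mul (star (smat T N u M)) (smat T N u M)) = toC mone by rewrite h.
rewrite toCM' toC_scale' e scale0r mulmx0 toC1.
by move/matrixP/(_ 0 0); rewrite !mxE => /eqP; rewrite eq_sym oner_eq0.
Qed.

Lemma omotion_scale b u M : unitary M -> unitary (smat T N u M) ->
  omotion b (smat T N u M) = omotion b M.
Proof.
move=> uM uuM; have c0 := oembed_neq0 uuM.
have uC := proj1 (U21P _) uuM; rewrite toC_scale' in uC.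
by rewrite /omotion toC_scale'; exact: (motion_scale b (proj1 (U21P M) uM) uC c0).
Qed.

Lemma omotion_faithful M K : unitary M -> unitary K -> omotion false M = omotion false K ->
  exists2 u, onorm T N u = 1%coqZ & K = smat T N u M.
Proof.
move=> uM uK /(motion_faithful (proj1 (U21P M) uM) (proj1 (U21P K) uK)) [c ec].
pose P := mul K (star M).
have eP : toC P = c%:M.
  by rewrite /P toCM' ec -scalemxAl -toCM' (proj2 uM) toC1 scalemx1.
have c11 : c = emb (m11 P).
  by move/matrixP: (eP) => /(_ 0 0); rewrite !mxE eqxx mulr1n.
have P1 : P = smat T N (m11 P) mone.
  by apply: (@toC_inj R d T N order_type); rewrite toC_scale' toC1 eP scalemx1 c11.
have uP : unitary P by apply: unitaryM uK (unitary_star uM).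
exists (m11 P).
  have := proj2 uP; rewrite {1 2}P1 mstar_scale smatl smatr smatA mstar1 mmul1 onormE.
  move/(congr1 (fun A => (m11 A).1)); rewrite /omul /=; lia.
have -> : K = mul P M by rewrite /P -mmulA (proj1 uM) mmulm1.
by rewrite {1}P1 smatl mmul1.
Qed.

Lemma PU21_OE f : PU21_O d f <-> exists2 M, unitary M & f = omotion false M.
Proof.
split=> [[A [uA intA indA]]|[M uM ->]].
  have /choice [g hg] (ij : 'I_3 * 'I_3) : exists x : oint, A ij.1 ij.2 = emb x.
    exact: (ring_of_integers_oembed order_type d_squarefree).
  pose M := Mat (g (0, 0)) (g (0, 1)) (g (0, 2)) (g (1, 0)) (g (1, 1)) (g (1, 2))
    (g (2, 0)) (g (2, 1)) (g (2, 2)).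
  have eA : A = toC M.
    by apply/matrixP; elim/forall_I3; elim/forall_I3; rewrite !mxE (hg (_, _)).
  exists M; first by apply/U21P; rewrite -eA.
  by rewrite /omotion -eA; apply/inducesP.
exists (toC M); split; first exact/U21P.
  by move=> i j; rewrite mxE; exact: (oembed_integral R order_type).
by apply/inducesP => //; exact/U21P.
Qed.

Variables (coset_nb : mat -> nat) (reps refls : seq mat).
Local Notation rep i := (nth mone reps i).
Local Notation sigma i := (nth mone refls i).
Local Notation even_word := (even_word T N refls).
Hypothesis coset_nb1 : coset_nb mone = 0%N.
Hypothesis coset_nb_congr : forall A B K, unitary A -> unitary B -> unitary K ->
  coset_nb A = coset_nb B -> coset_nb (mul A K) = coset_nb (mul B K).
Hypothesis coset_nb_scale : forall u A, onorm T N u = 1%coqZ -> unitary A ->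
  coset_nb (smat T N u A) = coset_nb A.
Hypothesis coset_nb_lt : forall A, unitary A -> (coset_nb A < size reps)%N.
Hypothesis rep_unitary : forall q, (q < size reps)%N -> unitary (rep q).
Hypothesis coset_nb_rep : forall q, (q < size reps)%N -> coset_nb (rep q) = q.
Hypothesis refl_ok : forall i, (i < size refls)%N ->
  unitary (sigma i) /\ mul (sigma i) (conj (sigma i)) = mone.
Hypothesis even_word_kernel : forall A, even_word A -> unitary A /\ coset_nb A = 0%N.
Hypothesis kernel_even : forall A, unitary A -> coset_nb A = 0%N ->
  exists u E, even_word E /\ A = smat T N u E.
Hypothesis refls_gt0 : (0 < size refls)%N.

(** The subgroup of coset number 0. The coset of f = [omotion false M] in the sense of left cosets
is determined by the coset number of the inverse of M. *)
Definition kernel : set (H2C R -> H2C R) :=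
  [set f | exists M, [/\ unitary M, coset_nb M = 0%N & f = omotion false M]].

Lemma coset_nb_star M : unitary M -> coset_nb M = 0%N -> coset_nb (star M) = 0%N.
Proof.
move=> uM cM; have := coset_nb_congr uM (unitary1 _ _) (unitary_star uM).
by rewrite (proj2 uM) mmul1 coset_nb1 => <-.
Qed.

Lemma coset_nb_kernelM M K : unitary M -> unitary K ->
  coset_nb M = 0%N -> coset_nb (mul M K) = coset_nb K.
Proof.
move=> uM uK cM; rewrite (coset_nb_congr uM (unitary1 _ _) uK) ?mmul1 //.
by rewrite cM coset_nb1.
Qed.

Lemma coset_nb_faithful M K : unitary M -> unitary K ->
  omotion false M = omotion false K -> coset_nb M = coset_nb K.
Proof.
move=> uM uK /(omotion_faithful uM uK) [u hu ->]; by rewrite coset_nb_scale.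
Qed.

Lemma kernel_group : transformation_group kernel.
Proof.
split.
- by exists mone; split=> //; [exact: unitary1|rewrite omotion1].
- move=> f g [M [uM cM ->]] [K [uK cK ->]].
  exists (mul M K); split; [exact: unitaryM|by rewrite coset_nb_kernelM|].
  by rewrite omotionM.
- move=> f [M [uM cM ->]]; have us := unitary_star uM.
  exists (omotion false (star M)); first by exists (star M); split=> //; exact: coset_nb_star.
  split=> p.
    by have := omotionM false false us uM; rewrite (proj1 uM) omotion1 => /(congr1 (fun h => h p)).
  by have := omotionM false false uM us; rewrite (proj2 uM) omotion1 => /(congr1 (fun h => h p)).
Qed.

Lemma kernel_subgroup : subgroup kernel (PU21_O d).
Proof.
split; first exact: kernel_group.
by move=> f [M [uM _ ->]]; apply/PU21_OE; exists M.
Qed.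

Lemma kernel_index : has_index kernel (PU21_O d) (size reps).
Proof.
apply: (has_index_reps (rep := fun i => omotion false (star (rep i)))).
- exact: kernel_group.
- move=> i hi; apply/PU21_OE; exists (star (rep i)) => //.
  exact/unitary_star/rep_unitary.
- move=> g /PU21_OE [M uM ->]; have us := unitary_star uM.
  have hi := coset_nb_lt us; exists (coset_nb (star M)); split=> //.
  have ur := rep_unitary hi.
  exists (omotion false (mul (rep (coset_nb (star M))) M)).
    exists (mul (rep (coset_nb (star M))) M); split=> //; first exact: unitaryM.
    rewrite (coset_nb_congr ur us uM); first by rewrite (proj1 uM).
    by rewrite coset_nb_rep.
  rewrite omotionM ?mmulA ?(proj1 ur) ?mmul1 //; first exact: unitary_star.
  exact: unitaryM.
- move=> i j h hi hj [M [uM cM ->]] e.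
  have ui := rep_unitary hi; have uj := rep_unitary hj.
  have e2 : omotion false (mul (rep j) (star (rep i))) = omotion false M.
    have := omotionM false false uj (unitary_star ui); rewrite e => <-.
    apply/funext => p /=.
    have := omotionM false false uj (unitary_star uj); rewrite (proj2 uj) omotion1.
    by move/(congr1 (fun h => h (omotion false M p))).
  have uji := unitaryM uj (unitary_star ui).
  have c0 : coset_nb (mul (rep j) (star (rep i))) = 0%N by rewrite (coset_nb_faithful uji uM e2).
  have := coset_nb_kernelM uji ui c0; rewrite -mmulA (proj1 ui) mmulm1 !coset_nb_rep //.
Qed.

Definition reflections : set (H2C R -> H2C R) :=
  [set s | exists2 i, (i < size refls)%N & s = omotion true (sigma i)].

Lemma reflections_real : reflections `<=` @real_reflection R.
Proof.
move=> s [i hi ->]; have [ui ei] := refl_ok hi.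
by apply: reflection_real; [exact/U21P|rewrite -toC_conj' -toCM' ei toC1].
Qed.

Lemma reflections_inv s : reflections s -> involutive s.
Proof. by case/reflections_real. Qed.

(** An even product of reflections is an even word; an odd one is a reflection times the conjugate
of an even word. *)
Lemma alternating_matrix b f : alternating_word reflections b f ->
  if b then
    exists i E, [/\ (i < size refls)%N, even_word E & f = omotion true (mul (sigma i) (conj E))]
  else exists2 E, even_word E & f = omotion false E.
Proof.
elim=> [|{}b s {}f [j hj ->] _]; first by exists mone; [exact: even_one|rewrite omotion1].
have [uj _] := refl_ok hj.
case: b => /= [[i [E [hi eE ->]]]|[E eE ->]].
  have [ui _] := refl_ok hi; have [uE _] := even_word_kernel eE.
  exists (mul (mul (sigma j) (conj (sigma i))) E); first exact: even_step.
  rewrite (omotionM true true uj (unitaryM ui (unitary_conj uE))).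
  by rewrite mconjM mconjK mmulA.
have [uE _] := even_word_kernel eE.
by exists j, E; split=> //; rewrite omotionM.
Qed.

Lemma even_alternating E : even_word E -> alternating_word reflections false (omotion false E).
Proof.
elim=> [|A i j hi hj eA IH]; first by rewrite omotion1; exact: alternating_id.
have [ui _] := refl_ok hi; have [uj _] := refl_ok hj; have [uA _] := even_word_kernel eA.
have -> : omotion false (mul (mul (sigma i) (conj (sigma j))) A) =
    omotion true (sigma i) \o (omotion true (sigma j) \o omotion false A).
  by rewrite compA (omotionM true true ui uj) (omotionM false false (unitaryM ui (unitary_conj uj)) uA).
apply: (@alternating_step _ _ true); first by exists i.
by apply: (@alternating_step _ _ false); first by exists j.
Qed.

Lemma kernel_alternating : kernel = [set f | alternating_word reflections false f].
Proof.
apply/seteqP; split=> f /=.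
  move=> [M [uM cM ->]]; have [u [E [eE eM]]] := kernel_even uM cM.
  have [uE _] := even_word_kernel eE; rewrite eM omotion_scale -?eM //.
  exact: even_alternating.
move/alternating_matrix => [E eE ->]; have [uE cE] := even_word_kernel eE.
by exists E.
Qed.

Lemma alternating_true_not_holomorphic f : alternating_word reflections true f -> ~ holomorphic f.
Proof.
move/alternating_matrix => [i [E [hi eE ->]]]; apply: omotion_not_holomorphic.
have [ui _] := refl_ok hi; have [uE _] := even_word_kernel eE.
exact: unitaryM ui (unitary_conj uE).
Qed.

Lemma alternating_false_holomorphic f : alternating_word reflections false f -> holomorphic f.
Proof.
move/alternating_matrix => [E eE ->]; apply: omotion_holomorphic.
by have [] := even_word_kernel eE.
Qed.

Lemma kernel_real_reflections : generated_by_real_reflections kernel.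
Proof.
exists reflections; split.
- exact: reflections_real.
- rewrite kernel_alternating (generated_alternating reflections_inv).
  apply/seteqP; split=> f /=.
    by move=> hf; split; [exists false|exact: alternating_false_holomorphic].
  by move=> [[[] //] /alternating_true_not_holomorphic].
- rewrite kernel_alternating; apply: (alternating_index reflections_inv (s0 := omotion true (sigma 0))).
    by exists 0%N.
  by move=> f /alternating_true_not_holomorphic h /alternating_false_holomorphic.
Qed.

Theorem reflection_subgroup_exists : exists H : set (H2C R -> H2C R),
  [/\ subgroup H (PU21_O d), has_index H (PU21_O d) (size reps) &
      generated_by_real_reflections H].
Proof.
exists kernel; split; [exact: kernel_subgroup|exact: kernel_index|].
exact: kernel_real_reflections.
Qed.

End Assembly.

(** Everything about d enters through the certificate. *)
Lemma certificate_reflection_subgroup (R : realType) (d : nat) (T N : Z) (c : certificate) :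
  order_parameters d T N ->
  (forall m : nat, (m * m %| d)%N -> m = 1%N) -> cert_valid T N c ->
  exists H : set (H2C R -> H2C R),
    [/\ subgroup H (PU21_O d), has_index H (PU21_O d) (size (cert_reps c)) &
        generated_by_real_reflections H].
Proof.
move=> dTN d_sqf; have TN := order_parameters_TN dTN; have discr_gt0 := order_discr dTN.
rewrite /cert_valid; case e : (cert_ideal c) => [[x y] z].
set t := cert_table T N c; clearbody t.
rewrite /cert_gens.
case/and5P=> /(units_okP discr_gt0 TN) units gensU covU hcov /and3P[idl refls_gt0 data].
have unitary_gens A : unitary T N A <-> word T N (gens T N (cert_unit c) (cert_bases c)) A.
  split; last exact: (word_unitary gensU).
  exact: (unitary_word discr_gt0 TN units gensU covU hcov).
have gens5 : nth mone (gens T N (cert_unit c) (cert_bases c)) 5 = smat T N (cert_unit c) mone by [].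
have gens_gt5 : (5 < size (gens T N (cert_unit c) (cert_bases c)))%N by [].
apply: (@reflection_subgroup_exists R d T N dTN d_sqf (coset_nb x y z t) (cert_reps c)
  (cert_reflections c)).
- exact: (coset_nb1 data).
- exact: (coset_nb_congr idl data unitary_gens).
- exact: (coset_nb_scale idl data unitary_gens gens_gt5 gens5 units).
- exact: (coset_nb_lt idl data unitary_gens gens_gt5).
- exact: (rep_unitary data).
- exact: (coset_nb_rep data).
- exact: (refl_ok data).
- exact: (even_word_kernel idl data unitary_gens).
- exact: (kernel_even idl data unitary_gens).
- exact: refls_gt0.
Qed.

Local Close Scope ring_scope.
Local Close Scope card_scope.
Local Close Scope classical_set_scope.

Theorem corollary5p1 (R : realType) :
  [/\ forall d : nat, d \in [:: 3; 7; 11] ->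
        exists H : set (H2C R -> H2C R),
          [/\ subgroup H (PU21_O d), has_index H (PU21_O d) 2 &
              generated_by_real_reflections H],
      exists H : set (H2C R -> H2C R),
        [/\ subgroup H (PU21_O 2), has_index H (PU21_O 2) 4 &
            generated_by_real_reflections H] &
      exists H : set (H2C R -> H2C R),
        [/\ subgroup H (PU21_O 1), has_index H (PU21_O 1) 8 &
            generated_by_real_reflections H]].
Proof.
have sqf (d : nat) : d \in [:: 1; 2; 3; 7; 11]%N ->
    forall m : nat, (m * m %| d)%N -> m = 1%N.
  rewrite !inE => hd m hm; have m3 : (m <= 3)%N.
    have d0 : (0 < d)%N by case/or4P: hd => [/eqP->|/eqP->|/eqP->|/orP[]/eqP->].
    have := dvdn_leq d0 hm; case/or4P: hd => [/eqP->|/eqP->|/eqP->|/orP[]/eqP->]; nia.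
  by case/or4P: hd hm => [/eqP->|/eqP->|/eqP->|/orP[]/eqP->];
    case: m m3 => [|[|[|[|]]]].
split=> [d||].
- rewrite !inE => /or3P[]/eqP->.
  + by apply: (certificate_reflection_subgroup R _ _ certificate_3_valid); [left|exact: sqf].
  + by apply: (certificate_reflection_subgroup R _ _ certificate_7_valid); [left|exact: sqf].
  + by apply: (certificate_reflection_subgroup R _ _ certificate_11_valid); [left|exact: sqf].
- by apply: (certificate_reflection_subgroup R _ _ certificate_2_valid); [right; auto|exact: sqf].
- by apply: (certificate_reflection_subgroup R _ _ certificate_1_valid); [right; auto|exact: sqf].
Qed.
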